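(* Suppose that $A$ is surjective (so that there is $\gamma>0$ with $|A^*q|_{\mathcal E'}\ge\gamma|q|_{\mathcal F'}$ for all $q\in\mathcal F'$), that $J:\mathcal E\to[0,\infty)$ satisfies (J1), (J2), (J3), and that $\psi:\mathcal E\to[0,\infty)$ satisfies ($\Psi$1), ($\Psi$2), ($\Psi$3). Let $f\in W^{1,2}([0,T];\mathcal F)$, and let $v_0\in\mathcal E$ be a critical point of $v\mapsto J(v)+\psi(v-v_0)$ on the affine space $\mathbf A(f(0))$. Then there exist $v\in BV([0,T];\mathcal E)$ and $q\in L^\infty([0,T];\mathcal F')$ such that: (A) $v$ is an approximable quasistatic evolution (with dissipation $\psi$) with initial condition $v_0$ and constraint $f$; (B) $A^*q(t)\in\partial J(v(t))+K^*$ for $\mathcal L^1$-a.e. $t\in[0,T]$; (C) the function $s\mapsto\langle q(s),\dot f(s)\rangle_{\mathcal F}$ belongs to $L^1(0,T)$, and for every $0\le t_1<t_2\le T$ $$J(v(t_2))+\mathrm{Var}_\psi(v;[t_1,t_2])\le J(v(t_1))+\int_{t_1}^{t_2}\langle q(s),\dot f(s)\rangle_{\mathcal F}\,\mathrm ds.$$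
   Context: Setting: $\mathcal E\simeq\mathbb R^n$ and $\mathcal F\simeq\mathbb R^m$ are Euclidean spaces with $n>m$, with duals $\mathcal E',\mathcal F'$; $A:\mathcal E\to\mathcal F$ is linear with adjoint $A^*:\mathcal F'\to\mathcal E'$; $T>0$; $\langle\cdot,\cdot\rangle$ denotes duality. For $g\in\mathcal F$, $\mathbf A(g):=\{v\in\mathcal E: Av=g\}$. Functions in $W^{1,2}([0,T];\mathcal F)$ are identified with their absolutely continuous representatives. $\mathbb N_0=\mathbb N\cup\{0\}$. Functions $v\in BV([0,T];\mathcal E)$ are functions of bounded (pointwise) variation, defined at every $t$ (not identified up to null sets). Fréchet subdifferential of $S:\mathcal E\to[0,\infty)$ at $u$: $\xi\in\partial S(u)\subset\mathcal E'$ iff $\liminf_{v\to u}\frac{S(v)-S(u)-\langle\xi,v-u\rangle_{\mathcal E}}{|v-u|_{\mathcal E}}\ge0$. Critical point: $u$ is a critical point of $S$ on $\mathbf A(g)$ if $Au=g$ and $\partial S(u)\cap\operatorname{ran}(A^* )\ne\emptyset$. Strong convexity: a convex $S:\mathcal E\to[0,\infty)$ is strongly convex if there is $\nu>0$ with $\nu|v_1-v_2|_{\mathcal E}^2\le\langle\xi_1-\xi_2,v_1-v_2\rangle_{\mathcal E}$ for all $v_1,v_2$, $\xi_1\in\partial S(v_1)$, $\xi_2\in\partial S(v_2)$. Assumptions on $J$: (J1) $v\mapsto J(v)+|Av|_{\mathcal F}^2$ is coercive (bounded sublevels); (J2) there is $\eta>0$ such that $v\mapsto J(v)+\eta|v|_{\mathcal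 E}^2$ is strongly convex; (J3) there is $L>0$ such that for every $v\in\mathcal E$, $\xi\in\partial J(v)$ implies $|\xi|_{\mathcal E'}\le L(J(v)+1)$. Assumptions on $\psi$: ($\Psi$1) $\psi(v)=0$ iff $v=0$; ($\Psi$2) $\psi(v_1+v_2)\le\psi(v_1)+\psi(v_2)$; ($\Psi$3) $\psi(\lambda v)=\lambda\psi(v)$ for $\lambda\ge0$. $K^*:=\partial\psi(0)=\{\xi\in\mathcal E':\langle\xi,w\rangle_{\mathcal E}\le\psi(w)\ \forall w\in\mathcal E\}$. $\psi$-variation: $\mathrm{Var}_\psi(u;[a,b])=\sup\{\sum_{i=1}^k\psi(u(t_i)-u(t_{i-1})): a=t_0<t_1<\dots<t_k=b,\ k\in\mathbb N\}$. Discrete quasistatic evolution with time step $\delta>0$, initial condition $v_0$ and constraint $f$: a right-continuous $v_\delta:[-\delta,T]\to\mathcal E$ such that $v_\delta(t)=v_0$ for $t\in[-\delta,\delta)$; $v_\delta$ is constant on $[0,T]\cap[i\delta,(i+1)\delta)$ for all $i\in\mathbb N_0$ with $i\delta\le T$; and $v_\delta(i\delta)$ is a critical point of $v\mapsto J(v)+\psi(v-v_\delta((i-1)\delta))$ on $\mathbf A(f(i\delta))$ for every $i\in\mathbb N_0$ with $i\delta\le T$. Approximable quasistatic evolution with initial condition $v_0$ and constraint $f$: a bounded measurable $v:[0,T]\to\mathcal E$ such that there exist a sequence $\delta_k\to0^+$ and discrete quasistatic evolutions $v_{\delta_k}$ with time step $\delta_k$, initial condition $v_0$ and constraint $f$,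 with $\liminf_{k\to\infty}|v_{\delta_k}(t)-v(t)|_{\mathcal E}=0$ for every $t\in[0,T]$. *)

(* Defs.v *)
From HB Require Import structures.
From mathcomp Require Import all_boot all_order all_algebra.
From mathcomp Require Import all_classical all_reals all_analysis.

Set Implicit Arguments.
Unset Strict Implicit.
Unset Printing Implicit Defensive.

Import Order.TTheory GRing.Theory Num.Theory.
Import numFieldNormedType.Exports.

Local Open Scope classical_set_scope.
Local Open Scope ring_scope.

(* Vectors of E = R^n and F = R^m are rows 'rV[R]_n and 'rV[R]_m, and elements
   of the dual spaces E' and F' are columns.  The linear map A : E -> F is the matrix
   A : 'M[R]_(n, m) acting by v |-> v *m A, so that its adjoint F' -> E' is
   q |-> A *m q (see duality_adjoint).
   Functions on [0, T] (or [-delta, T]) are total functions on R of which only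
   the values on the interval matter. *)

(* The Euclidean norm, both of rows and of columns: the norm `|_| of the
   library on matrices is the maximum norm.  Limits, neighbourhoods and
   bounded sets below are those of the library; all norms being equivalent,
   they are the Euclidean ones.  The operator norm on the dual is the
   Euclidean norm of the column. *)
Definition enorm {R : realType} {p k : nat} (M : 'M[R]_(p, k)) : R :=
  Num.sqrt (\sum_i \sum_j M i j ^+ 2).

Definition duality {R : realType} {n : nat} (xi : 'cV[R]_n) (v : 'rV[R]_n) : R :=
  (v *m xi) 0 0.

Lemma duality_adjoint {R : realType} {n m : nat} (A : 'M[R]_(n, m))
    (q : 'cV[R]_m) (v : 'rV[R]_n) :
  duality (A *m q) v = duality q (v *m A).
Proof. by rewrite /duality mulmxA. Qed.

Lemma dualityZ {R : realType} {n} (xi : 'cV[R]_n) (a : R) v :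
  duality xi (a *: v) = a * duality xi v.
Proof. by rewrite /duality -scalemxAl mxE. Qed.

Lemma enormZ {R : realType} {n} (a : R) (v : 'rV[R]_n) : 0 <= a ->
  enorm (a *: v) = a * enorm v.
Proof.
move=> a0; rewrite /enorm.
have -> : \sum_i \sum_j (a *: v) i j ^+ 2 = a ^+ 2 * \sum_i \sum_j v i j ^+ 2.
  rewrite mulr_sumr; apply: eq_bigr => i _; rewrite mulr_sumr.
  by apply: eq_bigr => j _; rewrite mxE exprMn.
by rewrite sqrtrM ?sqr_ge0// sqrtr_sqr ger0_norm.
Qed.

Lemma enorm_gt0 {R : realType} {n} (v : 'rV[R]_n) : v != 0 -> 0 < enorm v.
Proof.
move=> v0; rewrite /enorm sqrtr_gt0 lt_neqAle sumr_ge0 ?andbT; last first.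
  by move=> i _; apply: sumr_ge0 => j _; exact: sqr_ge0.
apply: contraNN v0; rewrite eq_sym psumr_eq0; last first.
  by move=> i _; apply: sumr_ge0 => j _; exact: sqr_ge0.
move=> /allP h; apply/eqP/matrixP => i j.
have := h i (mem_index_enum _); rewrite psumr_eq0; last by move=> ? _; exact: sqr_ge0.
move=> /allP /(_ j (mem_index_enum _)); rewrite sqrf_eq0 mxE => /eqP//.
Qed.

Section convexity.
Context {R : realType} {n : nat}.
Implicit Types (S : 'rV[R]_n -> R) (u : 'rV[R]_n).

Definition subdifferential S u : set 'cV[R]_n :=
  [set xi | (0%E <= limf_einf
     (fun v => ((S v - S u - duality xi (v - u)) / enorm (v - u))%:E) u^')%E].

Definition critical_point {m : nat} (A : 'M[R]_(n, m)) S (g : 'rV[R]_m) u :=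
  u *m A = g /\ subdifferential S u `&` range (fun q : 'cV[R]_m => A *m q) !=set0.

Definition strongly_convex S :=
  convex_function setT S /\
  exists2 nu : R, 0 < nu & forall v1 v2 xi1 xi2,
    subdifferential S v1 xi1 -> subdifferential S v2 xi2 ->
    nu * enorm (v1 - v2) ^+ 2 <= duality (xi1 - xi2) (v1 - v2).

Definition J1 {m : nat} (A : 'M[R]_(n, m)) (J : 'rV[R]_n -> R) :=
  forall c : R, bounded_set [set v | J v + enorm (v *m A) ^+ 2 <= c].

Definition J2 (J : 'rV[R]_n -> R) :=
  exists2 eta : R, 0 < eta & strongly_convex (fun v => J v + eta * enorm v ^+ 2).

Definition J3 (J : 'rV[R]_n -> R) :=
  exists2 L : R, 0 < L &
    forall v xi, subdifferential J v xi -> enorm xi <= L * (J v + 1).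

Definition Psi1 (psi : 'rV[R]_n -> R) := forall v, psi v = 0 <-> v = 0.

Definition Psi2 (psi : 'rV[R]_n -> R) :=
  forall v1 v2, psi (v1 + v2) <= psi v1 + psi v2.

Definition Psi3 (psi : 'rV[R]_n -> R) :=
  forall (lambda : R) v, 0 <= lambda -> psi (lambda *: v) = lambda * psi v.

Definition Kstar (psi : 'rV[R]_n -> R) : set 'cV[R]_n := subdifferential psi 0.

End convexity.

Lemma KstarE {R : realType} {n : nat} (psi : 'rV[R]_n -> R) :
  Psi1 psi -> Psi3 psi ->
  Kstar psi = [set xi | forall w, duality xi w <= psi w].
Proof.
move=> P1 P3; have psi0 : psi 0 = 0 by apply/P1.
apply/seteqP; split => xi; rewrite /Kstar /subdifferential/= limf_einfE => h; last first.
  apply: (@le_trans _ _ (ereal_inf ((fun v : 'rV[R]_n =>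
    ((psi v - psi 0 - duality xi (v - 0)) / enorm (v - 0))%:E) @` setT))); last first.
    by apply: ereal_sup_ubound; exists setT => //; exact: filterT.
  apply: le_ereal_inf_tmp => _ [v _ <-]; rewrite lee_fin psi0 !subr0.
  by rewrite divr_ge0 ?subr_ge0 ?sqrtr_ge0.
move=> w; rewrite leNgt; apply/negP => hw.
have w0 : w != 0.
  apply: contraTneq hw => ->; rewrite psi0 -(scale0r (0 : 'rV[R]_n)) dualityZ.
  by rewrite mul0r ltxx.
have ew := enorm_gt0 w0.
suff : (ereal_sup [set ereal_inf ((fun v : 'rV[R]_n =>
    ((psi v - psi 0 - duality xi (v - 0))%R / enorm (v - 0)%R)%:E) @` V) | V in (0%R : 'rV[R]_n)^']
    <= ((psi w - duality xi w) / enorm w)%:E)%E.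
  move=> /(le_trans h); rewrite lee_fin pmulr_lge0 ?invr_gt0//.
  by rewrite subr_ge0 leNgt hw.
apply: ge_ereal_sup => _ [V V0 <-].
have c : (fun s : R => s *: w) @ 0^'+ --> (0 : 'rV[R]_n).
  rewrite -[X in _ --> X](scale0r w); apply: cvgZr_tmp.
  exact: cvg_at_right_filter.
have [s [Vs s0]] : exists s : R, (s *: w != 0 -> V (s *: w)) /\ 0 < s.
  by apply: (@filter_ex _ 0^'+); near=> s; split; [near: s; exact: c V0|].
apply: ereal_inf_lbound; exists (s *: w).
  by apply: Vs; rewrite scaler_eq0 negb_or gt_eqF.
congr (_%:E); rewrite psi0 !subr0 P3 ?ltW// dualityZ enormZ ?ltW//.
by rewrite -mulrBr invfM mulrACA divff ?gt_eqF// mul1r.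
Unshelve. all: by end_near. Qed.

(* The phi-variation of u on [a, b].  A partition a = t_0 < ... < t_k = b is
   the sequence s = [:: t_1; ...; t_k] with itv_partition a b s. *)
Definition Var {R : realType} {n : nat} (phi : 'rV[R]_n -> R)
    (u : R -> 'rV[R]_n) (a b : R) : \bar R :=
  ereal_sup [set (\sum_(0 <= i < size s)
      phi (u (nth b (a :: s) i.+1) - u (nth b (a :: s) i)))%:E
    | s in itv_partition a b].

Definition BV_vec {R : realType} {n : nat} (T : R) (v : R -> 'rV[R]_n) :=
  (Var enorm v 0 T < +oo)%E.

Definition measurable_vec {R : realType} {p k : nat} (T : R)
    (h : R -> 'M[R]_(p, k)) :=
  forall i j, measurable_fun `[0, T] (fun t => h t i j).

(* L^p(0, T), coordinatewise *)
Definition Lp_vec {R : realType} {k l : nat} (p : \bar R) (T : R)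
    (h : R -> 'M[R]_(k, l)) :=
  forall i j, ((fun t : R => h t i j) \_ `[0, T]) \in Lfun (@lebesgue_measure R) p.

Definition absolutely_continuous_vec {R : realType} {m : nat} (T : R)
    (f : R -> 'rV[R]_m) :=
  forall e : R, 0 < e -> exists2 d : R, 0 < d &
    forall (N : nat) (a b : 'I_N -> R),
      (forall i, [/\ 0 <= a i, a i <= b i & b i <= T]) ->
      trivIset setT (fun i => `]a i, b i[%classic) ->
      \sum_i (b i - a i) < d ->
      \sum_i enorm (f (b i) - f (a i)) < e.

(* phi in C^1_c(]0, T[); the support is bounded, hence compact as soon as it is
   a closed subset of R contained in ]0, T[. *)
Definition test_function {R : realType} (T : R) (phi : R -> R) :=
  [/\ forall x : R, derivable phi x 1,
      continuous (derive1 phi) &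
      closure [set x | phi x != 0] `<=` `]0, T[].

Definition weak_derivative {R : realType} {m : nat} (T : R)
    (f df : R -> 'rV[R]_m) :=
  forall phi, test_function T phi -> forall j,
    (\int[lebesgue_measure]_(t in `[0%R, T]) (f t ord0 j * derive1 phi t)%:E =
     - \int[lebesgue_measure]_(t in `[0%R, T]) (df t ord0 j * phi t)%:E)%E.

(* f is the absolutely continuous representative of an element of
   W^{1,2}([0, T]; F) and df is (a representative of) its weak derivative *)
Definition W12 {R : realType} {m : nat} (T : R) (f df : R -> 'rV[R]_m) :=
  [/\ Lp_vec 2%:E T f, Lp_vec 2%:E T df, weak_derivative T f df &
      absolutely_continuous_vec T f].

Section evolutions.
Context {R : realType} {n m : nat}.
Variables (A : 'M[R]_(n, m)) (J psi : 'rV[R]_n -> R) (T : R).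
Variables (v0 : 'rV[R]_n) (f : R -> 'rV[R]_m).

Definition discrete_evolution (delta : R) (v : R -> 'rV[R]_n) :=
  [/\ forall t : R, - delta <= t < T -> v s @[s --> t^'+] --> v t,
      forall t : R, - delta <= t < delta -> t <= T -> v t = v0,
      forall i : nat, i%:R * delta <= T ->
        forall s t, i%:R * delta <= s < (i%:R + 1) * delta -> s <= T ->
          i%:R * delta <= t < (i%:R + 1) * delta -> t <= T -> v s = v t &
      forall i : nat, i%:R * delta <= T ->
        critical_point A (fun w => J w + psi (w - v ((i%:R - 1) * delta)))
          (f (i%:R * delta)) (v (i%:R * delta))].

Definition approximable_evolution (v : R -> 'rV[R]_n) :=
  [/\ bounded_set (v @` `[0, T]), measurable_vec T v &
      exists (delta : nat -> R) (vdelta : nat -> R -> 'rV[R]_n),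
        [/\ forall k, 0 < delta k,
            delta k @[k --> \oo] --> 0,
            forall k, discrete_evolution (delta k) (vdelta k) &
            forall t : R, 0 <= t <= T ->
              limn_einf (fun k => (enorm (vdelta k t - v t))%:E) = 0%E]].

End evolutions.

(* Main.v *)
Require Import Defs.
From HB Require Import structures.
From mathcomp Require Import all_boot all_order all_algebra.
From mathcomp Require Import all_classical all_reals all_analysis.
From mathcomp Require Import measurable_realfun ess_sup_inf.
From mathcomp Require Import ring lra.

Set Implicit Arguments.
Unset Strict Implicit.
Unset Printing Implicit Defensive.

Import Order.TTheory GRing.Theory Num.Theory.
Import numFieldNormedType.Exports.

Local Open Scope classical_set_scope.
Local Open Scope ring_scope.

(** The evolution is a limit of time-discrete ones, in which the state [x]
    moves at each step to a minimizer [z] of [J + psi (. - x)] on the affine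
    space prescribed by the constraint.  As [J] is not convex, the multiplier
    at [z] yields no energy inequality.  The remedy is an auxiliary point [y]
    that minimizes [J + psi (. - x) + eta |. - x|^2] on the same space, where
    [eta] comes from [J2].  This problem is convex, so its multiplier [q] gives
    [J y + psi (y - x) + eta |y - x|^2 <= J x + <q, g - x A>], and the minimality
    of [z] replaces [J y + psi (y - x)] on the left by [J z + psi (z - x)].
    One application of the Hahn-Banach theorem in finite dimension provides
    [q], together with a force [kappa] in [Kstar psi] such that
    [A q - kappa - 2 eta (y - x)] is a subgradient of [J] at [y]
    ([multiplier], [time_step_exists]).  Since [J3] bounds [q] by the energy,
    a discrete Gronwall argument bounds the states, the multipliers and the
    total dissipation independently of the time step
    ([discrete_solution_exists]).

    Helly's theorem then extracts a subsequence along which the states converge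
    at every time to [v], and the dissipation, which includes the proximal
    terms [eta |y - x|^2], to a monotone function [W]
    ([discrete_solution_compactness]).  The multipliers are merely bounded, and
    a weak limit of them would be useless for the nonlinear inclusion.  The
    function [q] is instead a measurable selection of pointwise cluster points,
    chosen so that [<q(s), f'(s)>] is the largest cluster value of the discrete
    powers ([limit_multiplier]).  This choice serves both conclusions.

    - Energy inequality: the positive part of the discrete power minus the
      limit power tends to [0] at each time, hence in mean by dominated
      convergence, so the discrete inequality passes to the limit
      ([limit_energy]).  The discrete work, a sum of increments of [f], is an
      integral of the weak derivative by [weak_derivative_ftc].
    - Inclusion: at a time where [W] does not jump to the right, the dissipation
      of the current step tends to [0].  Hence so does [y - x], and the
      subgradient relation at [y] passes to the limit along the subsequence
      that realizes [q] at this time ([prox_gap_cvg], [limit_inclusion]).  A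
      monotone function has at most countably many jumps
      ([right_jumps_negligible]). *)

(** * Norms and linear forms on rows *)

Lemma mx_coord_le (R : realType) (p k : nat) (M : 'M[R]_(p, k)) i j :
  `|M i j| <= `|M|.
Proof.
rewrite /Num.norm/= mx_normrE.
exact: (le_bigmax _ (fun ij => `|M ij.1 ij.2|) (i, j)).
Qed.

Lemma mx_norm_le (R : realType) (p k : nat) (M : 'M[R]_(p, k)) c :
  0 <= c -> (forall i j, `|M i j| <= c) -> `|M| <= c.
Proof.
move=> c0 h; rewrite [`|M|]/Num.norm/= mx_normrE.
by apply/bigmax_leP; split => // -[i j] _; exact: h.
Qed.

Lemma enorm_ge0 (R : realType) (p k : nat) (M : 'M[R]_(p, k)) : 0 <= enorm M.
Proof. exact: sqrtr_ge0. Qed.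

Lemma enorm_sqr (R : realType) (p k : nat) (M : 'M[R]_(p, k)) :
  enorm M ^+ 2 = \sum_i \sum_j M i j ^+ 2.
Proof.
by rewrite sqr_sqrtr// sumr_ge0// => i _; apply: sumr_ge0 => j _; exact: sqr_ge0.
Qed.

Lemma enorm_sqr_row (R : realType) (n : nat) (v : 'rV[R]_n) :
  enorm v ^+ 2 = duality v^T v.
Proof.
rewrite enorm_sqr big_ord1 /duality mxE.
by apply: eq_bigr => j _; rewrite mxE expr2.
Qed.

Lemma enorm_coord_le (R : realType) (p k : nat) (M : 'M[R]_(p, k)) i j :
  `|M i j| <= enorm M.
Proof.
rewrite -sqrtr_sqr ler_wsqrtr// (bigD1 i)//= (bigD1 j)//= -addrA lerDl.
by rewrite addr_ge0// sumr_ge0// => *; rewrite ?sumr_ge0// => *; rewrite sqr_ge0.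
Qed.

Lemma norm_le_enorm (R : realType) (p k : nat) (M : 'M[R]_(p, k)) :
  `|M| <= enorm M.
Proof.
by apply: mx_norm_le => [|i j]; [exact: enorm_ge0|exact: enorm_coord_le].
Qed.

Lemma enorm_le_norm (R : realType) (n : nat) (v : 'rV[R]_n) :
  enorm v <= n%:R * `|v|.
Proof.
case: n v => [v|n v].
  by rewrite mul0r /enorm big_ord1 big_ord0 sqrtr0.
rewrite -[leRHS](@ger0_norm _ (n.+1%:R * `|v|)) ?mulr_ge0// -sqrtr_sqr.
rewrite ler_wsqrtr// big_ord1 exprMn.
apply: (@le_trans _ _ (\sum_(j < n.+1) `|v| ^+ 2)).
  apply: ler_sum => j _; rewrite -real_normK ?num_real//.
  by rewrite lerXn2r ?nnegrE// mx_coord_le.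
rewrite sumr_const card_ord -[leLHS]mulr_natl; apply: ler_wpM2r; first exact: sqr_ge0.
by rewrite expr2 ler_peMl// ler1n.
Qed.

Lemma dualityE (R : realType) (n : nat) (xi : 'cV[R]_n) (v : 'rV[R]_n) :
  duality xi v = \sum_j v 0 j * xi j 0.
Proof. by rewrite /duality mxE. Qed.

Lemma dualityD (R : realType) (n : nat) (xi : 'cV[R]_n) v w :
  duality xi (v + w) = duality xi v + duality xi w.
Proof. by rewrite /duality mulmxDl mxE. Qed.

Lemma dualityN (R : realType) (n : nat) (xi : 'cV[R]_n) v :
  duality xi (- v) = - duality xi v.
Proof. by rewrite /duality mulNmx mxE. Qed.

Lemma dualityB (R : realType) (n : nat) (xi : 'cV[R]_n) v w :
  duality xi (v - w) = duality xi v - duality xi w.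
Proof. by rewrite dualityD dualityN. Qed.

Lemma dualityDl (R : realType) (n : nat) (xi zeta : 'cV[R]_n) v :
  duality (xi + zeta) v = duality xi v + duality zeta v.
Proof. by rewrite /duality mulmxDr mxE. Qed.

Lemma dualityNl (R : realType) (n : nat) (xi : 'cV[R]_n) v :
  duality (- xi) v = - duality xi v.
Proof. by rewrite /duality mulmxN mxE. Qed.

Lemma dualityZl (R : realType) (n : nat) (a : R) (xi : 'cV[R]_n) v :
  duality (a *: xi) v = a * duality xi v.
Proof. by rewrite /duality -scalemxAr mxE. Qed.

Lemma duality_trC (R : realType) (n : nat) (v w : 'rV[R]_n) :
  duality v^T w = duality w^T v.
Proof. by rewrite !dualityE; apply: eq_bigr => j _; rewrite !mxE mulrC. Qed.

Lemma duality_le (R : realType) (n : nat) (xi : 'cV[R]_n) (v : 'rV[R]_n) c :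
  (forall j, `|xi j 0| <= c) -> `|duality xi v| <= n%:R * c * `|v|.
Proof.
move=> h; rewrite dualityE (le_trans (ler_norm_sum _ _ _))//.
apply: (@le_trans _ _ (\sum_(j < n) c * `|v|)).
  by apply: ler_sum => j _; rewrite normrM mulrC ler_pM// mx_coord_le.
by rewrite sumr_const card_ord -[leLHS]mulr_natl mulrA.
Qed.

Lemma norm_mulmx_le (R : realType) (n m : nat) (B : 'M[R]_(n, m)) (v : 'rV[R]_n) :
  `|v *m B| <= n%:R * `|B| * `|v|.
Proof.
apply: mx_norm_le => [|i j]; first by rewrite !mulr_ge0.
have -> : (v *m B) i j = duality (col j B) v.
  by rewrite dualityE ord1 mxE; apply: eq_bigr => l _; rewrite !mxE.
by apply: duality_le => l; rewrite mxE mx_coord_le.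
Qed.

Lemma continuous_distP (R : realType) (U V : normedModType R) (f : U -> V) (u : U) :
  (forall e, 0 < e -> exists2 d, 0 < d &
     forall w, `|u - w| <= d -> `|f u - f w| <= e) ->
  {for u, continuous f}.
Proof.
move=> h; apply/cvgrPdist_le => e /h[d d0 hd]; near=> w; apply: hd.
by near: w; apply: (@cvgr_dist_le _ _ _ _ _ id).
Unshelve. all: by end_near. Qed.

Lemma dist_le_continuous (R : realType) (U V : normedModType R) (f : U -> V)
    (c : R) :
  (forall u w, `|f u - f w| <= c * `|u - w|) -> continuous f.
Proof.
move=> fc u; apply: continuous_distP => e e0.
have c0 : 0 < `|c| + 1 by rewrite ltr_wpDl.
exists (e / (`|c| + 1)) => [|w uw]; first by rewrite divr_gt0.
rewrite (le_trans (fc _ _))//.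
apply: (@le_trans _ _ ((`|c| + 1) * `|u - w|)).
  by apply: ler_wpM2r => //; rewrite ler_wpDr// ler_norm.
by rewrite mulrC -ler_pdivlMr.
Qed.

Lemma continuous_real_add (R : realType) (U : topologicalType) (f g : U -> R) :
  continuous f -> continuous g -> continuous (fun u => f u + g u).
Proof. by move=> cf cg u; apply: cvgD; [exact: cf|exact: cg]. Qed.

Lemma continuous_real_scale (R : realType) (U : topologicalType) (c : R) (f : U -> R) :
  continuous f -> continuous (fun u => c * f u).
Proof. by move=> cf u; apply: cvgMr; exact: cf. Qed.

Lemma mulmxr_continuous (R : realType) (n m : nat) (B : 'M[R]_(n, m)) :
  continuous (fun v : 'rV[R]_n => v *m B).
Proof.
apply: (@dist_le_continuous _ _ _ _ (n%:R * `|B|)) => v w.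
by rewrite -mulmxBl norm_mulmx_le.
Qed.

(** * Convex functions on a space of rows *)

Definition cvx (R : realType) (n : nat) (p : 'rV[R]_n -> R) :=
  forall x y t, 0 <= t <= 1 ->
    p (t *: x + (1 - t) *: y) <= t * p x + (1 - t) * p y.

Lemma convex_functionP (R : realType) (n : nat) (p : 'rV[R]_n -> R) :
  convex_function setT p -> cvx p.
Proof.
move=> cp x y t /andP[t0 t1].
by have := cp (Itv01 t0 t1) x y; rewrite !inE => /(_ I I).
Qed.

Section hahn_banach.
Context {R : realType} {n : nat}.
Implicit Types (p : 'rV[R]_n -> R).

(** The slope of the extended form along [e] is the infimum of the upper
    bounds [p (k + t e) / t]; convexity puts it above every lower bound
    coming from [t < 0]. *)
Lemma cvx_slope p (k : nat) (K : 'M[R]_(k, n)) (e : 'rV[R]_n) :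
  cvx p -> (forall h, (h <= K)%MS -> 0 <= p h) ->
  exists a : R, forall h t, (h <= K)%MS -> t * a <= p (h + t *: e).
Proof.
move=> cp p0.
have key (h h' : 'rV_n) (s t : R) : (h <= K)%MS -> (h' <= K)%MS -> 0 < s -> 0 < t ->
    - (p (h' - s *: e) / s) <= p (h + t *: e) / t.
  move=> hK h'K s0 t0; have st0 : 0 < s + t by rewrite addr_gt0.
  have st01 : 0 <= s / (s + t) <= 1.
    by rewrite divr_ge0 ?(ltW s0) ?(ltW st0)// ler_pdivrMr// mul1r lerDl ltW.
  have := cp (h + t *: e) (h' - s *: e) _ st01.
  have -> : (s / (s + t)) *: (h + t *: e) + (1 - s / (s + t)) *: (h' - s *: e)
     = (s / (s + t)) *: h + (t / (s + t)) *: h'.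
    by apply/rowP => j; rewrite !mxE; field; rewrite gt_eqF.
  have E1 : 1 - s / (s + t) = t / (s + t) by field; rewrite gt_eqF.
  rewrite E1 => /(le_trans (p0 _ _)) h0.
  have cK : (((s / (s + t)) *: h + (t / (s + t)) *: h')%R <= K)%MS.
    by rewrite addmx_sub ?scalemx_sub.
  move/(_ cK): h0 => h0.
  rewrite -subr_ge0 opprK.
  have -> : p (h + t *: e) / t + p (h' - s *: e) / s =
    (s + t) / (s * t) * (s / (s + t) * p (h + t *: e) +
       t / (s + t) * p (h' - s *: e)).
    by field; rewrite !gt_eqF.
  by rewrite mulr_ge0// divr_ge0 ?mulr_ge0// ltW.
pose U := [set r | exists h t, [/\ (h <= K)%MS, 0 < t & r = p (h + t *: e) / t]].
have U0 : U !=set0 by exists (p (0 + 1 *: e) / 1), 0, 1; rewrite sub0mx.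
have Ulb : has_lbound U.
  exists (- (p (0 - 1 *: e) / 1)) => _ [h [t [hK t0 ->]]].
  by apply: key; rewrite ?sub0mx.
exists (inf U) => h t hK; have [t0|t0|<-] := ltgtP 0 t.
- rewrite mulrC -ler_pdivlMr//; apply: ge_inf => //.
  by exists h, t.
- have : - (p (h - (- t) *: e) / - t) <= inf U.
    apply: lb_le_inf => // _ [h' [t' [h'K t'0 ->]]].
    by apply: key; rewrite ?oppr_gt0.
  by rewrite scaleNr opprK invrN mulrN opprK ler_ndivrMr// mulrC.
- by rewrite mul0r scale0r addr0 p0.
Qed.

(** Finite-dimensional Hahn-Banach theorem: the form is corrected one
    direction at a time, by replacing [p] with [p] minus a form that vanishes
    on [K]; this keeps convexity and enlarges the space where [0 <= p]. *)
Lemma hahn_banach_row p (k : nat) (K : 'M[R]_(k, n)) :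
  cvx p -> (forall h, (h <= K)%MS -> 0 <= p h) ->
  exists2 xi : 'cV[R]_n, (forall h, (h <= K)%MS -> duality xi h = 0) &
    forall h, duality xi h <= p h.
Proof.
have [d] := ubnP (n - \rank K)%N; elim: d => // d IH in p k K *.
rewrite ltnS => dK cp p0.
have [fK|nfK] := boolP (row_full K).
  exists 0 => h; rewrite /duality mulmx0 mxE//.
  by move=> *; apply: p0; exact: submx_full.
have [e eK] : exists e : 'rV[R]_n, ~~ (e <= K)%MS.
  apply: contrapT => H; case/negP: nfK; rewrite -sub1mx.
  by apply/row_subP => i; apply/negPn/negP => Hi; apply: H; exists (row i 1%:M).
have [a ha] := cvx_slope e cp p0.
have : e *m cokermx K != 0 by rewrite -submxE.
move=> /rV0Pn[j ej].
pose lam : 'cV[R]_n := (a / (e *m cokermx K) 0 j) *: col j (cokermx K).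
have lamK h : (h <= K)%MS -> duality lam h = 0.
  rewrite submxE => /eqP hK; rewrite /lam dualityZl.
  suff -> : duality (col j (cokermx K)) h = (h *m cokermx K) 0 j.
    by rewrite hK [X in _ * X]mxE mulr0.
  by rewrite dualityE mxE; apply: eq_bigr => i _; rewrite !mxE.
have lame : duality lam e = a.
  rewrite /lam dualityZl.
  suff -> : duality (col j (cokermx K)) e = (e *m cokermx K) 0 j by rewrite divfK.
  by rewrite dualityE mxE; apply: eq_bigr => i _; rewrite !mxE.
pose p' h := p h - duality lam h.
have cp' : cvx p'.
  move=> x y t t01; rewrite /p' dualityD !dualityZ.
  have := cp x y t t01; lra.
have p'0 h : (h <= (K + e)%MS)%MS -> 0 <= p' h.
  move=> /sub_addsmxP[u ->]; rewrite [u.2]mx11_scalar mul_scalar_mx /p'.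
  rewrite dualityD dualityZ lame lamK ?submxMl// add0r subr_ge0 ha//.
  exact: submxMl.
have [|xi xiK xip] := IH p' _ (K + e)%MS _ cp' p'0.
  apply: leq_trans dK; rewrite ltn_sub2l//.
    by rewrite ltn_neqAle rank_leq_col andbT; exact: nfK.
  have Kle := mxrank_leqif_sup (addsmxSl K e).
  rewrite ltn_neqAle Kle.1 Kle.2 andbT; apply: contra eK.
  exact: submx_trans (addsmxSr K e).
exists (xi + lam) => h.
  move=> hK; rewrite dualityDl lamK// xiK ?addr0//.
  exact: submx_trans hK (addsmxSl K e).
by rewrite dualityDl -lerBrDr; exact: xip.
Qed.

End hahn_banach.

Section convex_continuity.
Context {R : realType} {n : nat}.
Implicit Types (p : 'rV[R]_n -> R).

Lemma cvx_segment p x d (s : R) : cvx p -> `|s| <= 1 ->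
  p (x + s *: d) <= `|p (x + d)| + `|p (x - d)|.
Proof.
move=> cp; rewrite ler_norml => /andP[s1 s2].
have t01 : 0 <= (1 + s) / 2 <= 1 by apply/andP; split; lra.
have := cp (x + d) (x - d) _ t01.
have -> : ((1 + s) / 2) *: (x + d) + (1 - (1 + s) / 2) *: (x - d) = x + s *: d.
  by apply/rowP => j; rewrite !mxE; field.
move/le_trans; apply; have /andP[t0 t1] := t01.
have := ler_norm (p (x + d)); have := ler_norm (p (x - d)).
have := normr_ge0 (p (x + d)); have := normr_ge0 (p (x - d)); nra.
Qed.

(** Coordinates are freed one at a time: a point with one more free coordinate
    is the midpoint of a point with fewer of them and a point of an axis. *)
Lemma cvx_bounded_above p x (r : R) : cvx p -> 0 <= r ->
  exists M : R, forall h, `|h| <= r -> p (x + h) <= M.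
Proof.
move=> cp r0.
suff : forall (s : seq 'I_n) (r : R), 0 <= r -> exists M : R, forall h : 'rV[R]_n,
    (forall j, j \notin s -> h 0 j = 0) -> `|h| <= r -> p (x + h) <= M.
  move=> /(_ (enum 'I_n) r r0)[M hM]; exists M => h; apply: hM => j.
  by rewrite mem_enum.
elim=> [|j s IH] {r0}r r0.
  exists (p x) => h h0 _; suff -> : h = 0 by rewrite addr0.
  by apply/rowP => j; rewrite h0// mxE.
have [M hM] := IH (2 * r) (mulr_ge0 (ler0n R 2) r0).
pose d : 'rV[R]_n := (2 * r) *: 'e_j.
exists (2^-1 * M + 2^-1 * (`|p (x + d)| + `|p (x - d)|)) => h h0 hr.
pose h1 : 'rV[R]_n := \row_k (if k == j then 0 else 2 * h 0 k).
have ->: x + h = 2^-1 *: (x + h1) + (1 - 2^-1) *: (x + (2 * h 0 j) *: 'e_j).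
  apply/rowP => k; rewrite !mxE eqxx/=.
  by have [->|kj] := eqVneq k j; rewrite /= ?mulr1 ?mulr0; field.
apply: le_trans (cp _ _ _ _) _; first by apply/andP; split; lra.
have E : 1 - 2^-1 = 2^-1 :> R by field.
rewrite E lerD// ler_pM2l ?invr_gt0//.
  apply: hM => [k ks|].
    rewrite mxE; case: eqVneq => // kj; rewrite h0 ?mulr0// inE negb_or kj//.
  apply: mx_norm_le => [|i k]; first by rewrite mulr_ge0.
  rewrite ord1 mxE; case: eqVneq => _; first by rewrite normr0 mulr_ge0.
  rewrite normrM ger0_norm// ler_pM2l//.
  exact: le_trans (mx_coord_le _ _ _) hr.
have hjr : `|h 0 j| <= r by exact: le_trans (mx_coord_le _ _ _) hr.
have [r00|r00] := eqVneq r 0.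
  have -> : h 0 j = 0 by apply/eqP; rewrite -normr_le0 -r00.
  rewrite mulr0 scale0r addr0 /d r00 mulr0 scale0r addr0 subr0.
  by rewrite ler_wpDr// ler_norm.
have rp : 0 < r by rewrite lt_neqAle eq_sym r00.
have -> : (2 * h 0 j) *: ('e_j : 'rV[R]_n) = (h 0 j / r) *: d.
  by rewrite /d scalerA; congr (_ *: _); field.
apply: cvx_segment => //.
by rewrite normrM normfV (gtr0_norm rp) ler_pdivrMr// mul1r.
Qed.

(** An upper bound [M] near [x] suffices: if [`|u| <= 1], then [x + t u] lies
    between [x] and [x + u], and [x] lies between [x + t u] and [x - u], whence
    [`|p (x + t u) - p x| <= t (M - p x)]. *)
Lemma cvx_continuous p : cvx p -> continuous p.
Proof.
move=> cp x; have [M hM] := cvx_bounded_above x cp ler01.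
have xM : p x <= M by rewrite -[x]addr0 hM// normr0.
have key (h : 'rV[R]_n) (t : R) : 0 < t -> t <= 1 -> `|h| <= t ->
    `|p (x + h) - p x| <= t * (M - p x).
  move=> t0 t1 ht; pose u := t^-1 *: h.
  have u1 : `|u| <= 1.
    by rewrite normrZ normfV gtr0_norm// mulrC ler_pdivrMr// mul1r.
  have hu : h = t *: u by rewrite scalerA divff ?scale1r// gt_eqF.
  rewrite ler_norml; apply/andP; split.
    have t1p : 0 < 1 + t by rewrite addr_gt0.
    have s01 : 0 <= (1 + t)^-1 <= 1.
      by rewrite invr_ge0 (ltW t1p) invf_le1// lerDl ltW.
    have := cp (x + h) (x - u) _ s01.
    have -> : (1 + t)^-1 *: (x + h) + (1 - (1 + t)^-1) *: (x - u) = x.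
      apply/rowP => j; rewrite /u !mxE; field.
      by rewrite !gt_eqF.
    have := hM (- u); rewrite normrN => /(_ u1).
    move=> pu px.
    have : (1 + t) * p x <= p (x + h) + t * p (x - u).
      rewrite mulrC -ler_pdivlMr//; apply: le_trans px _.
      rewrite le_eqVlt; apply/orP; left; apply/eqP; field.
      by rewrite gt_eqF.
    by nra.
  have := cp (x + u) x t; rewrite (ltW t0) t1 => /(_ isT).
  have -> : t *: (x + u) + (1 - t) *: x = x + h.
    by apply/rowP => j; rewrite [in RHS]hu !mxE; ring.
  have := hM u u1; by nra.
apply: (@continuous_distP R 'rV[R]_n R^o) => e e0.
pose t := Num.min 1 (e / (M - p x + 1)).
have Mp : 0 < M - p x + 1 by rewrite ltr_wpDl// subr_ge0.
have t0 : 0 < t by rewrite lt_min ltr01 divr_gt0.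
exists t => // w xw; rewrite distrC -[w](subrKC x).
apply: le_trans (key _ _ t0 _ _) _; rewrite ?ge_min ?lexx// 1?distrC//.
apply: (@le_trans _ _ (t * (M - p x + 1))).
  by apply: ler_wpM2l; [exact: ltW|rewrite lerDl].
by rewrite -ler_pdivlMr// ge_min lexx orbT.
Qed.

End convex_continuity.

Lemma enorm_sqrD (R : realType) (n : nat) (v w : 'rV[R]_n) :
  enorm (v + w) ^+ 2 = enorm v ^+ 2 + 2 * duality v^T w + enorm w ^+ 2.
Proof.
rewrite !enorm_sqr_row linearD/= dualityDl !dualityD (duality_trC w v); ring.
Qed.

Lemma enormN (R : realType) (n : nat) (v : 'rV[R]_n) : enorm (- v) = enorm v.
Proof.
rewrite /enorm; congr Num.sqrt; apply: eq_bigr => i _; apply: eq_bigr => j _.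
by rewrite mxE sqrrN.
Qed.

Lemma enorm_sqr_cvx (R : realType) (n : nat) :
  cvx (fun v : 'rV[R]_n => enorm v ^+ 2).
Proof.
move=> x y t /andP[t0 t1]; rewrite !enorm_sqr !big_ord1 !mulr_sumr -big_split/=.
apply: ler_sum => j _; rewrite !mxE.
rewrite -subr_ge0 [leRHS](_ : _ = t * (1 - t) * (x ord0 j - y ord0 j) ^+ 2).
  by apply: mulr_ge0; [rewrite mulr_ge0// subr_ge0|exact: sqr_ge0].
ring.
Qed.

Lemma enorm_sqr_continuous (R : realType) (n : nat) :
  continuous (fun v : 'rV[R]_n => enorm v ^+ 2).
Proof. exact/cvx_continuous/enorm_sqr_cvx. Qed.

(** A quadratic error is negligible against the distance in the difference
    quotients of the Fréchet subdifferential. *)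
Lemma quadratic_subdifferential (R : realType) (n : nat) (S : 'rV[R]_n -> R)
    (u : 'rV[R]_n) (xi : 'cV[R]_n) (eta : R) : 0 <= eta ->
  (forall w, S u + duality xi (w - u) - eta * enorm (w - u) ^+ 2 <= S w) ->
  subdifferential S u xi.
Proof.
move=> eta0 h; rewrite /subdifferential/= limf_einfE.
apply/lee_addgt0Pr => e e0.
pose c := eta * n%:R + 1.
have c0 : 0 < c by rewrite ltr_wpDl// mulr_ge0.
rewrite -leeBlDr// sub0e.
apply: (@le_trans _ _ (ereal_inf ((fun v : 'rV[R]_n =>
   ((S v - S u - duality xi (v - u)) / enorm (v - u))%:E) @` ball u (e / c)))).
  apply: le_ereal_inf_tmp => _ [v uv <-]; rewrite -EFinN lee_fin.
  move: uv; rewrite mx_norm_ball /ball_/= => uv.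
  have [->|vu] := eqVneq v u.
    rewrite !subrr sub0r -{1}(scale0r (0 : 'rV[R]_n)) dualityZ mul0r oppr0 mul0r.
    by rewrite oppr_le0 ltW.
  have en0 : 0 < enorm (v - u) by apply: enorm_gt0; rewrite subr_eq0.
  rewrite ler_pdivlMr//.
  apply: (@le_trans _ _ (- eta * enorm (v - u) ^+ 2)); last by have := h v; lra.
  rewrite expr2 mulrA !mulNr lerN2; apply: ler_wpM2r; first exact: ltW.
  apply: (@le_trans _ _ (eta * (n%:R * `|v - u|))).
    by rewrite ler_wpM2l// enorm_le_norm.
  rewrite mulrA distrC; apply: (@le_trans _ _ (c * `|u - v|)).
    by rewrite ler_wpM2r// lerDl.
  by rewrite mulrC -ler_pdivlMr// ltW.
apply: ereal_sup_ubound; exists (ball u (e / c)) => //.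
rewrite /dnbhs/= /within/=.
have := nbhsx_ballx u _ (divr_gt0 e0 c0).
by apply: filterS.
Qed.

(** * Gauges *)

Section gauge.
Context {R : realType} {n : nat}.
Variable psi : 'rV[R]_n -> R.
Hypotheses (psi_ge0 : forall v, 0 <= psi v) (P1 : Psi1 psi) (P2 : Psi2 psi)
  (P3 : Psi3 psi).

Lemma gauge_cvx : cvx psi.
Proof.
move=> x y t /andP[t0 t1]; apply: le_trans (P2 _ _) _.
by rewrite !P3// subr_ge0.
Qed.

Lemma gauge_le_norm : exists2 C : R, 0 <= C & forall v, psi v <= C * `|v|.
Proof.
have [M hM] := cvx_bounded_above 0 gauge_cvx ler01.
have M0 : 0 <= M.
  by have := hM 0; rewrite addr0 normr0 => /(_ ler01); apply: le_trans.
exists M => // v; have [->|v0] := eqVneq v 0.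
  by rewrite (P1 0).2// normr0 mulr0.
have nv : `|v| != 0 by rewrite normr_eq0.
rewrite -{1}[v]scale1r -(divff nv) -scalerA P3// mulrC.
apply: ler_wpM2r => //; rewrite -[_ *: v]add0r; apply: hM.
by rewrite normrZ normfV normr_id mulVf.
Qed.

(** The minimum of [psi] on the unit sphere is positive. *)
Lemma gauge_ge_norm : exists2 c : R, 0 < c & forall v, c * `|v| <= psi v.
Proof.
pose Sph := [set v : 'rV[R]_n | `|v| = 1].
have [[w w1]|S0] := pselect (Sph !=set0); last first.
  exists 1 => // v; rewrite mul1r; have [->|v0] := eqVneq v 0.
    by rewrite normr0.
  exfalso; apply: S0; exists (`|v|^-1 *: v).
  by rewrite /Sph/= normrZ normfV normr_id mulVf// normr_eq0.
have cS : compact Sph.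
  apply: bounded_closed_compact.
    exists 1; split => // r r1 v; rewrite /Sph/= => ->; exact: ltW.
  have -> : Sph = (fun v : 'rV[R]_n => `|v|) @^-1` [set 1] by [].
  apply: closed_comp => [v _|]; first exact: norm_continuous.
  exact: closed_eq.
have [|c cSph hc] := @EVT_min_rV R n psi Sph (ex_intro _ w w1) cS.
  by apply: continuous_subspaceT => v; exact: (cvx_continuous gauge_cvx).
move: cSph; rewrite inE => c1.
exists (psi c).
  rewrite lt_neqAle psi_ge0 andbT eq_sym; apply/eqP => /P1 c0.
  by move: c1; rewrite /Sph/= c0 normr0 => /esym/eqP; rewrite oner_eq0.
move=> v; have [->|v0] := eqVneq v 0; first by rewrite normr0 mulr0 psi_ge0.
have nv : `|v| != 0 by rewrite normr_eq0.
rewrite -[in leRHS](scale1r v) -(divff nv) -scalerA P3// mulrC.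
apply: ler_wpM2l => //; apply: hc; rewrite inE /Sph/=.
by rewrite normrZ normfV normr_id mulVf.
Qed.

End gauge.

(** * Constrained minimization and Lagrange multipliers *)

Section constrained.
Context {R : realType} {n m : nat}.
Variables (A : 'M[R]_(n, m)).
Hypothesis surjA : forall g : 'rV[R]_m, exists v : 'rV[R]_n, v *m A = g.

Lemma right_inverse : exists B : 'M[R]_(m, n), B *m A = 1%:M.
Proof.
have [b hb] := choice (fun i : 'I_m => surjA (row i 1%:M)).
exists (\matrix_(i < m) b i); apply/row_matrixP => i.
by rewrite row_mul rowK hb.
Qed.

(** If [B] is a right inverse of [A], then [v - v A B] lies in the kernel of
    [v |-> v A]. *)
Lemma duality_ker (xi : 'cV[R]_n) :
  (forall h : 'rV[R]_n, h *m A = 0 -> duality xi h = 0) ->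
  exists q : 'cV[R]_m, A *m q = xi.
Proof.
move=> h; have [B BA] := right_inverse.
exists (B *m xi); apply/trmx_inj/rowP => j.
have E (zeta : 'cV[R]_n) : zeta^T 0 j = duality zeta 'e_j.
  by rewrite /duality -rowE !mxE.
rewrite !E; apply/eqP; rewrite -subr_eq0 -opprB oppr_eq0 subr_eq0.
rewrite mulmxA /duality mulmxA -/(duality xi _) -/(duality xi _).
rewrite -subr_eq0 -dualityB h//.
by rewrite mulmxBl -!mulmxA BA mulmx1 subrr.
Qed.

Variables (J : 'rV[R]_n -> R).
Hypothesis hJ1 : J1 A J.

Lemma constrained_minimizer (Phi : 'rV[R]_n -> R) (g : 'rV[R]_m) :
  continuous Phi -> (forall v, J v <= Phi v) ->
  exists2 z, z *m A = g & forall w, w *m A = g -> Phi z <= Phi w.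
Proof.
move=> cPhi JPhi; have [w0 w0g] := surjA g.
pose D := [set w : 'rV[R]_n | w *m A = g] `&` [set w | Phi w <= Phi w0].
have D0 : D !=set0 by exists w0; split => /=.
have cD : compact D.
  apply: bounded_closed_compact.
    have [M [Mreal hM]] := hJ1 (Phi w0 + enorm g ^+ 2).
    exists M; split => // r Mr v [/= vg vP]; apply: hM => //=.
    by rewrite vg lerD2r (le_trans (JPhi v)).
  apply: closedI.
    have -> : [set w : 'rV[R]_n | w *m A = g] =
      (fun w => w *m A) @^-1` [set g] by [].
    apply: closed_comp => [v _|]; first exact: mulmxr_continuous.
    exact: (accessible_closed_set1 (hausdorff_accessible (@norm_hausdorff _ _))).
  have -> : [set w | Phi w <= Phi w0] = Phi @^-1` [set r | r <= Phi w0] by [].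
  by apply: closed_comp => [v _|]; [exact: cPhi|exact: closed_le].
have [|z] := @EVT_min_rV R n Phi D D0 cD.
  by apply: continuous_subspaceT => v; exact: cPhi.
rewrite inE => -[zg zw0] hz; exists z => // w wg.
have [ww0|/ltW w0w] := leP (Phi w) (Phi w0); last exact: le_trans zw0 w0w.
by apply: hz; rewrite inE.
Qed.

Variables (psi : 'rV[R]_n -> R) (eta : R).
Hypotheses (psi_cvx : cvx psi) (S_cvx : cvx (fun v => J v + eta * enorm v ^+ 2)).

(** Sum rule and Lagrange multiplier rule in one application of Hahn-Banach:
    the energy and the dissipation depend on separate copies of the variable,
    which are constrained to be equal and to be moved in the kernel of [A].
    The quadratic term convexifies the energy whatever its centre [c]. *)
Lemma multiplier (x c z : 'rV[R]_n) :
  (forall w, w *m A = z *m A ->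
     J z + psi (z - x) + eta * enorm (z - c) ^+ 2 <=
     J w + psi (w - x) + eta * enorm (w - c) ^+ 2) ->
  exists (q : 'cV[R]_m) (kappa : 'cV[R]_n),
    (forall h, psi (z - x) + duality kappa h <= psi (z - x + h)) /\
    (forall w, J z + duality (A *m q - kappa - (2 * eta) *: (z - c)^T) (w - z)
        - eta * enorm (w - z) ^+ 2 <= J w).
Proof.
move=> zmin.
pose S v := J v + eta * enorm (v - c) ^+ 2.
have SE v : S v = J v + eta * enorm v ^+ 2 +
    (- (2 * eta) * duality c^T v + eta * enorm c ^+ 2).
  by rewrite /S enorm_sqrD enormN dualityN duality_trC; ring.
have cS : cvx S.
  move=> v w t t01; rewrite !SE; have := S_cvx v w t01.
  rewrite dualityD !dualityZ; lra.
pose p (u : 'rV[R]_(n + n)) := (S (z + lsubmx u) - S z) +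
   (psi (z - x + rsubmx u) - psi (z - x)).
have cp : cvx p.
  move=> u w t t01; rewrite /p.
  have -> : z + lsubmx (t *: u + (1 - t) *: w) =
    t *: (z + lsubmx u) + (1 - t) *: (z + lsubmx w).
    by apply/rowP => j; rewrite !mxE; ring.
  have -> : z - x + rsubmx (t *: u + (1 - t) *: w) =
    t *: (z - x + rsubmx u) + (1 - t) *: (z - x + rsubmx w).
    by apply/rowP => j; rewrite !mxE; ring.
  have := cS (z + lsubmx u) (z + lsubmx w) t t01.
  have := psi_cvx (z - x + rsubmx u) (z - x + rsubmx w) t01.
  lra.
have [|xi xi0 xip] := hahn_banach_row (K := row_mx (kermx A) (kermx A)) cp.
- move=> _ /submxP[D ->]; rewrite /p mul_mx_row row_mxKl row_mxKr.
  have -> : z - x + D *m kermx A = (z + D *m kermx A) - x by rewrite addrAC.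
  have := zmin (z + D *m kermx A).
  rewrite mulmxDl -mulmxA mulmx_ker mulmx0 addr0 => /(_ erefl).
  by rewrite /S; lra.
pose xi1 := usubmx xi; pose kappa := dsubmx xi.
have xiE h h' : duality xi (row_mx h h') = duality xi1 h + duality kappa h'.
  by rewrite /duality -[xi]vsubmxK mul_row_col mxE.
have [|q qE] := @duality_ker (xi1 + kappa).
  move=> h /eqP hA; rewrite dualityDl -xiE xi0//.
  by have /submxP[D ->] : (h <= kermx A)%MS by [exact/sub_kermxP/eqP];
     rewrite -mul_mx_row submxMl.
exists q, kappa; split => [h|w].
  have := xip (row_mx 0 h); rewrite xiE /p row_mxKl row_mxKr addr0.
  by rewrite -(scale0r (0 : 'rV[R]_n)) dualityZ mul0r; lra.
have := xip (row_mx (w - z) 0); rewrite xiE /p row_mxKl row_mxKr addr0.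
rewrite -(scale0r (0 : 'rV[R]_n)) dualityZ mul0r subrKC qE.
rewrite !dualityDl !dualityNl dualityZl /S.
have -> : w - c = (z - c) + (w - z) by rewrite [RHS]addrC addrA subrK.
rewrite (enorm_sqrD (z - c)); lra.
Qed.

End constrained.

(** * One time step *)

Section time_step.
Context {R : realType} {n m : nat}.
Variables (A : 'M[R]_(n, m)) (J psi : 'rV[R]_n -> R) (eta : R).

(** The step goes from [x] to [z]; the auxiliary point [y] minimizes the energy
    with a proximal term centred at [x], and carries the multiplier [q] of the
    energy balance. *)
Record time_step (C : R) (x : 'rV[R]_n) (g : 'rV[R]_m) (y z : 'rV[R]_n)
    (q : 'cV[R]_m) (kappa : 'cV[R]_n) : Prop := {
  step_critical : critical_point A (fun w => J w + psi (w - x)) g z ;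
  step_Kstar : forall h, duality kappa h <= psi h ;
  step_subgradient : forall w,
    J y + duality (A *m q - kappa - (2 * eta) *: (y - x)^T) (w - y)
      - eta * enorm (w - y) ^+ 2 <= J w ;
  step_prox_energy : J y + psi (y - x) + eta * enorm (y - x) ^+ 2 <=
    J x + duality q (g - x *m A) ;
  step_energy : J z + psi (z - x) <= J y + psi (y - x) ;
  step_multiplier : forall h,
    `|duality q h| <= C * (J y + 1 + eta * enorm (y - x) ^+ 2) * `|h| }.

Hypothesis surjA : forall g : 'rV[R]_m, exists v : 'rV[R]_n, v *m A = g.
Hypotheses (J_ge0 : forall v, 0 <= J v) (hJ1 : J1 A J) (hJ3 : J3 J).
Hypotheses (eta_ge0 : 0 <= eta) (S_cvx : cvx (fun v => J v + eta * enorm v ^+ 2)).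
Hypotheses (psi_ge0 : forall v, 0 <= psi v) (P1 : Psi1 psi) (P2 : Psi2 psi)
  (P3 : Psi3 psi).

Let psi_cvx : cvx psi := gauge_cvx P2 P3.

Lemma semiconvex_continuous : continuous J.
Proof.
have -> : J = (fun v => (J v + eta * enorm v ^+ 2) - eta * enorm v ^+ 2).
  by apply/funext => v; rewrite addrK.
under eq_fun do rewrite -mulNr.
apply: continuous_real_add; first exact: (cvx_continuous S_cvx).
exact/continuous_real_scale/enorm_sqr_continuous.
Qed.

Let psi_shift_continuous (x : 'rV[R]_n) : continuous (fun w : 'rV[R]_n => psi (w - x)).
Proof.
apply: cvx_continuous => u w t t01.
rewrite (_ : _ - x = t *: (u - x) + (1 - t) *: (w - x)) ?psi_cvx//.
by apply/rowP => j; rewrite !mxE; ring.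
Qed.

Let prox_continuous (x : 'rV[R]_n) : continuous (fun w : 'rV[R]_n => eta * enorm (w - x) ^+ 2).
Proof.
apply: cvx_continuous => u w t t01.
rewrite (_ : t *: u + (1 - t) *: w - x = t *: (u - x) + (1 - t) *: (w - x)).
  by have := ler_wpM2l eta_ge0 (enorm_sqr_cvx (u - x) (w - x) t01); lra.
by apply/rowP => j; rewrite !mxE; ring.
Qed.

Lemma gauge_subgradient (x y : 'rV[R]_n) (kappa : 'cV[R]_n) :
  (forall h, psi (y - x) + duality kappa h <= psi (y - x + h)) ->
  (forall h, duality kappa h <= psi h) /\ psi (y - x) <= duality kappa (y - x).
Proof.
move=> hk; split=> [h|].
  by have := hk h; have := P2 (y - x) h; lra.
by have := hk (- (y - x)); rewrite subrr (P1 0).2// dualityN; lra.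
Qed.

(** Both [y] and [z] are minimizers on the affine space of [g], with and without
    the proximal term.  This term makes the problem for [y] convex, so that the
    comparison of [y] with [x], which lies on another affine space, costs only
    the work of [q]; and [J3] bounds [q], because a right inverse of [A]
    recovers it from the subgradients at [y]. *)
Lemma time_step_exists : exists2 C : R, 0 < C &
  forall x g, exists y z q kappa, time_step C x g y z q kappa.
Proof.
have [L L0 hL] := hJ3.
have [Cp Cp0 hCp] := gauge_le_norm psi_ge0 P1 P2 P3.
have [B BA] := right_inverse surjA.
pose C := (n%:R * L + Cp + n%:R * (1 + eta)) * (m%:R * `|B|) + 1.
have C1 : 0 <= n%:R * L + Cp + n%:R * (1 + eta).
  by rewrite !addr_ge0// mulr_ge0 ?addr_ge0// ltW.
exists C; first by rewrite ltr_wpDl// !mulr_ge0.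
move=> x g.
have cJ := semiconvex_continuous.
have [|v|y yg ymin] := @constrained_minimizer _ _ _ _ surjA _ hJ1
   (fun w => J w + psi (w - x) + eta * enorm (w - x) ^+ 2) g.
- apply: continuous_real_add; last exact: prox_continuous.
  exact: continuous_real_add.
- by rewrite -addrA lerDl addr_ge0// mulr_ge0// sqr_ge0.
have [|v|z zg zmin] := @constrained_minimizer _ _ _ _ surjA _ hJ1
   (fun w => J w + psi (w - x)) g.
- exact: continuous_real_add.
- by rewrite lerDl.
have [|q [kappa [hk hq]]] := multiplier surjA psi_cvx S_cvx (x := x) (c := x) (z := y).
  by move=> w wA; apply: ymin; rewrite wA.
have [|q' [kappa' [hk' hq']]] := multiplier surjA psi_cvx S_cvx (x := x) (c := z) (z := z).
  move=> w wA; apply: lerD; first by apply: zmin; rewrite wA.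
  have -> : enorm (z - z) = 0.
    by rewrite subrr; apply/eqP; rewrite -sqrf_eq0 enorm_sqr_row /duality mul0mx mxE.
  by rewrite expr0n/= mulr0 mulr_ge0// sqr_ge0.
have [kK kyx] := gauge_subgradient hk.
pose xi := A *m q - kappa - (2 * eta) *: (y - x)^T.
have xiJ : subdifferential J y xi by apply: (quadratic_subdifferential eta_ge0).
exists y, z, q, kappa; split => //.
- split => //; exists (A *m q'); split; last by exists q'.
  apply: (quadratic_subdifferential eta_ge0) => w.
  have := hk' (w - z); have := hq' w.
  rewrite subrr linear0 scaler0 subr0 dualityDl dualityNl.
  have -> : z - x + (w - z) = w - x by rewrite addrC addrA subrK.
  lra.
- have := hq x; rewrite !dualityDl !dualityNl dualityZl.
  have -> : x - y = - (y - x) by rewrite opprB.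
  rewrite !dualityN enormN enorm_sqr_row duality_adjoint mulmxBl yg; lra.
- exact: zmin.
- move=> h; set E := J y + 1 + _.
  have enx : 0 <= eta * enorm (y - x) ^+ 2 by rewrite mulr_ge0// sqr_ge0.
  have E1 : 1 <= E by rewrite /E; have := J_ge0 y; lra.
  have -> : duality q h = duality (A *m q) (h *m B).
    by rewrite duality_adjoint -mulmxA BA mulmx1.
  have : A *m q = xi + kappa + (2 * eta) *: (y - x)^T by rewrite addrAC /xi !subrK.
  move: (xi) xiJ => zeta zetaJ ->.
  set k := h *m B; rewrite !dualityDl dualityZl.
  have b1 : `|duality zeta k| <= n%:R * L * E * `|k|.
    apply: le_trans (duality_le _ (c := L * E) _) _; last by rewrite !mulrA.
    move=> j; apply: le_trans (enorm_coord_le _ _ _) _.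
    by apply: le_trans (hL _ _ zetaJ) _; rewrite ler_pM2l// /E; lra.
  have b2 : `|duality kappa k| <= Cp * E * `|k|.
    apply: (@le_trans _ _ (Cp * `|k|)).
      rewrite ler_norml; apply/andP; split; last exact: le_trans (kK _) (hCp _).
      by rewrite lerNl -dualityN (le_trans (kK _))// (le_trans (hCp _))// normrN.
    by apply: ler_wpM2r => //; rewrite ler_peMr.
  have b3 : `|2 * eta * duality (y - x)^T k| <= n%:R * (1 + eta) * E * `|k|.
    rewrite normrM ger0_norm ?mulr_ge0//.
    have : `|duality (y - x)^T k| <= n%:R * enorm (y - x) * `|k|.
      by apply: duality_le => j; rewrite mxE; exact: enorm_coord_le.
    move=> /(ler_wpM2l (mulr_ge0 (ler0n R 2) eta_ge0)) /le_trans; apply.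
    rewrite [leLHS](_ : _ = n%:R * (2 * eta * enorm (y - x)) * `|k|); last ring.
    apply: ler_wpM2r => //; rewrite -[leRHS]mulrA; apply: ler_wpM2l => //.
    apply: (@le_trans _ _ (eta * (1 + enorm (y - x) ^+ 2))).
      rewrite [leLHS](_ : _ = eta * (2 * enorm (y - x))); last ring.
      by apply: ler_wpM2l => //; have := sqr_ge0 (enorm (y - x) - 1); lra.
    rewrite mulrDr mulr1 mulrDl mul1r.
    have : eta <= eta * E by rewrite ler_peMr.
    by rewrite /E; have := J_ge0 y; lra.
  have kB : `|k| <= m%:R * `|B| * `|h| by exact: norm_mulmx_le.
  apply: (@le_trans _ _ ((n%:R * L + Cp + n%:R * (1 + eta)) * E * `|k|)).
    apply: le_trans (ler_normD _ _) _; apply: le_trans (lerD (ler_normD _ _) (lexx _)) _.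
    by move: b1 b2 b3; lra.
  have E0 : 0 <= E by exact: le_trans E1.
  apply: le_trans (ler_wpM2l (mulr_ge0 C1 E0) kB) _.
  rewrite /C -subr_ge0.
  rewrite [leRHS](_ : _ = E * `|h|); first by rewrite mulr_ge0.
  ring.
Qed.

End time_step.

(** * Discrete evolutions *)

Section discrete.
Context {R : realType} {n m : nat}.
Variables (A : 'M[R]_(n, m)) (J psi : 'rV[R]_n -> R) (eta : R).
Variables (v0 : 'rV[R]_n) (f : R -> 'rV[R]_m).

(** The index [i] of [y], [q] and [kappa] is that of the step from [x i] to
    [x i.+1]; the constant [M] is to be chosen before [delta]. *)
Record discrete_solution (M delta : R) (x y : nat -> 'rV[R]_n)
    (q : nat -> 'cV[R]_m) (kappa : nat -> 'cV[R]_n) : Prop := {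
  ds_init : x 0%N = v0 ;
  ds_critical : forall i, critical_point A (fun w => J w + psi (w - x i))
    (f (i.+1%:R * delta)) (x i.+1) ;
  ds_Kstar : forall i h, duality (kappa i) h <= psi h ;
  ds_subgradient : forall i w,
    J (y i) + duality (A *m q i - kappa i - (2 * eta) *: (y i - x i)^T) (w - y i)
      - eta * enorm (w - y i) ^+ 2 <= J w ;
  ds_energy : forall i,
    J (x i.+1) + (psi (x i.+1 - x i) + eta * enorm (y i - x i) ^+ 2) <=
    J (x i) + duality (q i) (f (i.+1%:R * delta) - f (i%:R * delta)) ;
  ds_bounded : forall i, `|x i| <= M ;
  ds_multiplier : forall i j, `|q i j 0| <= M ;
  ds_force : forall i j, `|kappa i j 0| <= M ;
  ds_variation : forall i,
    \sum_(l < i) (psi (x l.+1 - x l) + eta * enorm (y l - x l) ^+ 2) <= M }.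

Hypothesis surjA : forall g : 'rV[R]_m, exists v : 'rV[R]_n, v *m A = g.
Hypotheses (J_ge0 : forall v, 0 <= J v) (hJ1 : J1 A J) (hJ3 : J3 J).
Hypotheses (eta_ge0 : 0 <= eta) (S_cvx : cvx (fun v => J v + eta * enorm v ^+ 2)).
Hypotheses (psi_ge0 : forall v, 0 <= psi v) (P1 : Psi1 psi) (P2 : Psi2 psi)
  (P3 : Psi3 psi).
Hypothesis v0A : v0 *m A = f 0.
Variables (F : R -> R) (MF : R).
Hypotheses (F_le : forall t : R, 0 <= t -> F t - F 0 <= MF)
  (fF : forall a b : R, 0 <= a -> a <= b -> `|f b - f a| <= F b - F a)
  (f_unif : forall e : R, 0 < e -> exists2 d : R, 0 < d &
     forall a b : R, 0 <= a -> a <= b -> b <= a + d -> `|f b - f a| <= e).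

(** While a step of the constraint is so small that the multiplier can be
    absorbed, the energy grows by at most a factor [1 + 2 C `|f b - f a|];
    discrete Gronwall then bounds the energy, and with it the multipliers and
    the total variation. *)
Lemma discrete_solution_exists : exists2 M : R, 0 < M &
  exists2 d : R, 0 < d & forall delta : R, 0 < delta <= d ->
    exists x y q kappa, discrete_solution M delta x y q kappa.
Proof.
have [C C0 hC] := time_step_exists surjA J_ge0 hJ1 hJ3 eta_ge0 S_cvx psi_ge0 P1 P2 P3.
have /choice[D hD] : forall xg : 'rV[R]_n * 'rV[R]_m, exists d : 'rV[R]_n * 'rV[R]_n *
    'cV[R]_m * 'cV[R]_n, time_step A J psi eta C xg.1 xg.2 d.1.1.1 d.1.1.2 d.1.2 d.2.
  by move=> [x g]; have [y [z [q [k h]]]] := hC x g; exists (y, z, q, k).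
have [Cp Cp0 hCp] := gauge_le_norm psi_ge0 P1 P2 P3.
have C20 : 0 < (2 * C)^-1 by rewrite invr_gt0 mulr_gt0.
have [d d0 hd] := f_unif C20.
have MF0 : 0 <= MF by have := F_le (lexx 0); rewrite subrr.
have jv0 : 0 < J v0 + 1 by rewrite ltr_wpDl.
pose M1 := (J v0 + 1) * expR (2 * C * MF).
have M10 : 0 < M1 by rewrite mulr_gt0// expR_gt0.
(* Coercivity turns bounds on the energy and on the constraint into bounds on
   the states. *)
have [Mb [Mbr hMb]] := hJ1 (M1 + (m%:R * (MF + `|f 0|)) ^+ 2).
pose M := Num.max (Num.max (Mb + 1) (2 * C * M1)) (Num.max Cp (J v0 + 2 * C * M1 * MF)) + 1.
have [MMb MMq] : Mb + 1 <= M /\ 2 * C * M1 <= M.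
  by split; apply: ler_wpDr => //; rewrite !le_max lexx ?orbT.
have [MCp MV] : Cp <= M /\ J v0 + 2 * C * M1 * MF <= M.
  by split; apply: ler_wpDr => //; rewrite !le_max lexx ?orbT.
have CM0 : 0 < 2 * C * M1 by rewrite mulr_gt0// mulr_gt0.
exists M; first exact: lt_le_trans CM0 MMq.
exists d => // delta /andP[delta0 deltad].
pose x := fix x i := if i is j.+1 then (D (x j, f (j.+1%:R * delta))).1.1.2 else v0.
pose dat i := D (x i, f (i.+1%:R * delta)).
pose y i := (dat i).1.1.1; pose q i := (dat i).1.2; pose kappa i := (dat i).2.
have st i : time_step A J psi eta C (x i) (f (i.+1%:R * delta)) (y i) (x i.+1) (q i) (kappa i).
  exact: (hD (x i, f (i.+1%:R * delta))).
have xA i : x i *m A = f (i%:R * delta).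
  by case: i => [|i]; [rewrite mul0r|have [] := step_critical (st i)].
pose a i := `|f (i.+1%:R * delta) - f (i%:R * delta)|.
have idelta0 i : 0 <= i%:R * delta :> R by rewrite mulr_ge0// ltW.
have Sdelta i : i.+1%:R * delta = i%:R * delta + delta :> R.
  by rewrite -natr1 mulrDl mul1r.
have ale i : C * a i <= 2^-1.
  rewrite mulrC -ler_pdivlMr// -invfM; apply: hd => //.
    by rewrite Sdelta lerDl ltW.
  by rewrite Sdelta lerD2l.
have aF i : a i <= F (i.+1%:R * delta) - F (i%:R * delta).
  by apply: fF => //; rewrite Sdelta lerDl ltW.
have a0 i : 0 <= a i by exact: normr_ge0.
pose E i := J (y i) + 1 + eta * enorm (y i - x i) ^+ 2.
have en0 i : 0 <= eta * enorm (y i - x i) ^+ 2 by rewrite mulr_ge0// sqr_ge0.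
have E0 i : 0 < E i by rewrite /E; have := J_ge0 (y i); have := en0 i; lra.
have qa i : duality (q i) (f (i.+1%:R * delta) - f (i%:R * delta)) <= C * a i * E i.
  apply: le_trans (ler_norm _) _; apply: le_trans (step_multiplier (st i) _) _.
  by rewrite -/(E i) -/(a i); lra.
have prox i := step_prox_energy (st i).
have ener i := step_energy (st i).
(* At most half of [E i] is spent on the work; the factor comes from
   [(1 - s)^-1 <= 1 + 2 s] for [s <= 1/2]. *)
have EJ i : E i <= (J (x i) + 1) * (1 + 2 * (C * a i)).
  have : E i * (1 - C * a i) <= J (x i) + 1.
    have := prox i; have := psi_ge0 (y i - x i); have := qa i; rewrite xA /E; lra.
  have s0 : 0 <= C * a i by rewrite mulr_ge0// ltW.
  have := ale i; move: (C * a i) s0 => s s0 s1 h.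
  have : E i * (1 - s) * (1 + 2 * s) <= (J (x i) + 1) * (1 + 2 * s).
    by apply: ler_wpM2r => //; lra.
  apply: le_trans; rewrite -mulrA ler_peMr ?(ltW (E0 i))//; nra.
have JJ i : J (x i.+1) + 1 <= (J (x i) + 1) * (1 + 2 * (C * a i)).
  have : J (x i.+1) + 1 <= J (x i) + 1 + C * a i * E i.
    have := prox i; have := ener i; have := psi_ge0 (x i.+1 - x i); have := qa i.
    by have := en0 i; rewrite xA; lra.
  have s0 : 0 <= C * a i by rewrite mulr_ge0// ltW.
  have := ale i; have := EJ i; move: (C * a i) s0 => s s0 h s1 h'.
  have B0 : 0 <= J (x i) + 1 by rewrite addr_ge0.
  have E2 : E i <= (J (x i) + 1) * 2.
    by apply: le_trans h _; apply: ler_wpM2l => //; lra.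
  by apply: le_trans h' _; have := ler_wpM2l s0 E2; lra.
have Jexp i : J (x i) + 1 <= (J v0 + 1) * expR (2 * C * (F (i%:R * delta) - F 0)).
  elim: i => [|i IH]; first by rewrite mul0r subrr mulr0 expR0 mulr1.
  apply: le_trans (JJ i) _.
  have -> : 2 * C * (F (i.+1%:R * delta) - F 0) = 2 * C * (F (i%:R * delta) - F 0)
    + 2 * C * (F (i.+1%:R * delta) - F (i%:R * delta)) by ring.
  rewrite expRD [leRHS]mulrA; apply: ler_pM => //.
  - by rewrite addr_ge0.
  - by rewrite addr_ge0// !mulr_ge0// ltW.
  - apply: le_trans (expR_ge1Dx _); rewrite lerD2l mulrA ler_pM2l ?mulr_gt0//.
(* The exponent telescopes along the increments of [F], so the bound does not
   depend on the time step. *)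
have JM i : J (x i) + 1 <= M1.
  apply: le_trans (Jexp i) _; rewrite ler_pM2l// ler_expR ler_pM2l ?mulr_gt0//.
  exact: F_le.
have EM i : E i <= 2 * M1.
  apply: le_trans (EJ i) _; rewrite mulrC; apply: ler_pM.
  - by rewrite addr_ge0// !mulr_ge0// ltW.
  - by rewrite addr_ge0.
  - by have := ale i; lra.
  - exact: JM.
have qh i h : `|duality (q i) h| <= 2 * C * M1 * `|h|.
  apply: le_trans (step_multiplier (st i) h) _; apply: ler_wpM2r => //.
  by rewrite -/(E i) (mulrC 2) -mulrA ler_pM2l.
have enersum i : J (x i.+1) + (psi (x i.+1 - x i) + eta * enorm (y i - x i) ^+ 2) <=
    J (x i) + duality (q i) (f (i.+1%:R * delta) - f (i%:R * delta)).
  by have := prox i; have := ener i; rewrite xA; lra.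
exists x, y, q, kappa; split => //.
- by move=> i; exact: step_critical (st i).
- by move=> i; exact: step_Kstar (st i).
- by move=> i; exact: step_subgradient (st i).
- move=> i; apply: le_trans MMb; apply: (hMb (Mb + 1)); first by rewrite ltrDl.
  rewrite /= xA lerD//; first by have := JM i; lra.
  rewrite lerXn2r ?nnegrE ?enorm_ge0 ?mulr_ge0 ?addr_ge0//.
  apply: le_trans (enorm_le_norm _) _; apply: ler_wpM2l => //.
  rewrite -[f _](subrK (f 0)); apply: le_trans (ler_normD _ _) _.
  rewrite lerD2r; apply: le_trans (F_le (idelta0 i)); exact: fF.
- move=> i j; have := qh i 'e_j; rewrite /duality -rowE mxE.
  have -> : `|'e_j : 'rV[R]_m| = 1.
    apply/le_anti/andP; split; last by have := mx_coord_le ('e_j : 'rV[R]_m) 0 j;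
      rewrite mxE !eqxx normr1.
    apply: mx_norm_le => // k l; rewrite mxE; case: (_ && _); rewrite ?normr1 ?normr0//.
  by rewrite mulr1 => /le_trans; apply.
- move=> i j; have e1 : `|'e_j : 'rV[R]_n| <= 1.
    apply: mx_norm_le => // k l; rewrite mxE; case: (_ && _); rewrite ?normr1 ?normr0//.
  have -> : kappa i j 0 = duality (kappa i) 'e_j by rewrite /duality -rowE mxE.
  have kb h : `|h| <= 1 -> duality (kappa i) h <= M.
    move=> h1; apply: le_trans (step_Kstar (st i) _) _.
    apply: le_trans (hCp _) _; apply: le_trans MCp.
    by rewrite ler_piMr.
  by rewrite ler_norml lerNl -dualityN !kb// normrN.
- move=> i; apply: le_trans MV.
  have : J (x i) + \sum_(l < i) (psi (x l.+1 - x l) + eta * enorm (y l - x l) ^+ 2) <=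
     J v0 + 2 * C * M1 * (F (i%:R * delta) - F 0).
    elim: i => [|i IH]; first by rewrite big_ord0 mul0r subrr mulr0.
    rewrite big_ord_recr/=.
    have := enersum i; have := qh i (f (i.+1%:R * delta) - f (i%:R * delta)).
    move=> /(le_trans (ler_norm _)); rewrite -/(a i).
    have := ler_wpM2l (ltW CM0) (aF i).
    rewrite -/(x _) in IH *; move: IH; lra.
  have := ler_wpM2l (ltW CM0) (F_le (idelta0 i)).
  have := J_ge0 (x i); lra.
Qed.

End discrete.

(** * Absolutely continuous functions with a weak derivative *)

Section ramp.
Context {R : realType}.
Implicit Types (c e t : R).

Let pos c t : R := Num.max (t - c) 0.

Let pos_bound c t h : `|pos c (t + h) ^+ 2 - pos c t ^+ 2 - 2 * pos c t * h| <= h ^+ 2.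
Proof.
rewrite /pos ler_norml.
by case: (leP (t + h - c) 0); case: (leP (t - c) 0) => *; apply/andP; split; nra.
Qed.

Lemma is_derive_sqr_pos c t : is_derive t 1 (fun s => pos c s ^+ 2) (2 * pos c t).
Proof.
have lim : (fun h : R => h^-1 *: (((fun s => pos c s ^+ 2) \o shift t) (h *: 1) - pos c t ^+ 2))
    @ 0^' --> 2 * pos c t.
  apply/cvgrPdist_le => e e0; near=> h => /=.
  have h0 : h != 0 by near: h; exact: nbhs_dnbhs_neq.
  rewrite /GRing.scale/= mulr1 (addrC h t) distrC.
  have -> : h^-1 * (pos c (t + h) ^+ 2 - pos c t ^+ 2) - 2 * pos c t =
     h^-1 * (pos c (t + h) ^+ 2 - pos c t ^+ 2 - 2 * pos c t * h) by field.
  rewrite normrM normfV mulrC ler_pdivrMr ?normr_gt0//.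
  apply: le_trans (pos_bound _ _ _) _; rewrite -real_normK ?num_real// expr2.
  apply: ler_wpM2r => //; near: h; apply: dnbhs0_le; exact: e0.
apply: DeriveDef; first by apply/cvg_ex; exists (2 * pos c t).
by rewrite /derive; apply/cvg_lim.
Unshelve. all: by end_near. Qed.

(** [ramp c e] is the C^1 quadratic spline that climbs from [0] to [1] on
    [c, c + e], and [tent c e] is its derivative. *)
Definition ramp c e t : R :=
  2 / e ^+ 2 * pos c t ^+ 2 - 4 / e ^+ 2 * pos (c + e / 2) t ^+ 2
  + 2 / e ^+ 2 * pos (c + e) t ^+ 2.

Definition tent c e t : R :=
  4 / e ^+ 2 * pos c t - 8 / e ^+ 2 * pos (c + e / 2) t + 4 / e ^+ 2 * pos (c + e) t.

Lemma is_derive_ramp c e t : is_derive t 1 (ramp c e) (tent c e t).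
Proof.
have h1 := is_derive_sqr_pos c t.
have h2 := is_derive_sqr_pos (c + e / 2) t.
have h3 := is_derive_sqr_pos (c + e) t.
have H := is_deriveD (is_deriveB (is_deriveZ (2 / e ^+ 2) h1)
  (is_deriveZ (4 / e ^+ 2) h2)) (is_deriveZ (2 / e ^+ 2) h3).
apply: is_derive_eq H _; rewrite /GRing.scale/= /tent; ring.
Qed.

Lemma derivable_ramp c e t : derivable (ramp c e) t 1.
Proof. by case: (is_derive_ramp c e t). Qed.

Lemma derive1_ramp c e t : derive1 (ramp c e) t = tent c e t.
Proof. by rewrite derive1E; case: (is_derive_ramp c e t). Qed.

Lemma tent_continuous c e : continuous (tent c e).
Proof.
have pc d : continuous (pos d).
  move=> t; apply: (@continuous_max R R (fun s => s - d) (fun=> 0)).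
    by apply: cvgB; [exact: cvg_id|exact: cvg_cst].
  exact: cvg_cst.
move=> t; apply: cvgD; first apply: cvgB; apply: cvgMr; exact: pc.
Qed.

Let posE c e t : 0 < e -> pos c t = e * Num.max ((t - c) / e) 0.
Proof.
move=> e0; rewrite /pos; have [h|h] := leP (t - c) 0.
  rewrite max_r ?mulr0//; rewrite mulr_le0_ge0// invr_ge0 ltW//.
have h' : 0 <= (t - c) / e by rewrite divr_ge0// ltW.
by rewrite (max_l h') [RHS]mulrC divfK// gt_eqF.
Qed.

Lemma ramp_itv c e t : 0 < e -> 0 <= ramp c e t <= 1.
Proof.
move=> e0; pose s := (t - c) / e.
have tE : t = c + s * e by rewrite /s divfK ?subrKC// gt_eqF.
have -> : ramp c e t = 2 * Num.max s 0 ^+ 2 - 4 * Num.max (s - 2^-1) 0 ^+ 2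
    + 2 * Num.max (s - 1) 0 ^+ 2.
  rewrite /ramp !(posE _ _ e0).
  have -> : (t - c) / e = s by [].
  have -> : (t - (c + e / 2)) / e = s - 2^-1 by rewrite /s; field; rewrite gt_eqF.
  have -> : (t - (c + e)) / e = s - 1 by rewrite /s; field; rewrite gt_eqF.
  by field; rewrite gt_eqF.
have [s0|s0] := leP s 0.
  by rewrite !max_r; [apply/andP; split; lra|lra|lra].
have [s1|s1] := leP (s - 2^-1) 0.
  by rewrite !max_r; [apply/andP; split; nra|lra].
rewrite ?(max_l (ltW s1)) ?(max_l (ltW s0)).
have [s2|s2] := leP (s - 1) 0; last by apply/andP; split; lra.
rewrite expr0n/= mulr0 addr0.
rewrite [X in 0 <= X](_ : _ = 1 - 2 * (1 - s) ^+ 2); last by field.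
have := sqr_ge0 (1 - s); have : (1 - s) ^+ 2 <= 2^-1 ^+ 2 by rewrite lerXn2r ?nnegrE; lra.
by move=> h1 h2; apply/andP; split; lra.
Qed.

Lemma ramp_left c e t : 0 < e -> t <= c -> ramp c e t = 0.
Proof.
by move=> e0 tc; rewrite /ramp /pos !max_r; [ring|lra|lra|lra].
Qed.

Lemma ramp_right c e t : 0 < e -> c + e <= t -> ramp c e t = 1.
Proof.
move=> e0 tc; rewrite /ramp /pos !max_l; [|lra|lra|lra].
by field; rewrite gt_eqF.
Qed.

Lemma tent_ge0 c e t : 0 < e -> 0 <= tent c e t.
Proof.
move=> e0.
have -> : tent c e t = 4 / e ^+ 2 * (pos c t - 2 * pos (c + e / 2) t + pos (c + e) t).
  by rewrite /tent; ring.
apply: mulr_ge0; first by rewrite divr_ge0// sqr_ge0.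
rewrite /pos; case: (leP (t - c) 0); case: (leP (t - (c + e / 2)) 0);
  case: (leP (t - (c + e)) 0) => *; lra.
Qed.

Lemma tent_out c e t : 0 < e -> t <= c \/ c + e <= t -> tent c e t = 0.
Proof.
move=> e0 [tc|tc]; rewrite /tent /pos.
  by rewrite !max_r; [ring|lra|lra|lra].
by rewrite !max_l; [field; rewrite gt_eqF|lra|lra|lra].
Qed.

End ramp.

Section weak_derivative_ftc.
Context {R : realType}.
Notation mu := (@lebesgue_measure R).

Lemma tent_integral (c e lo hi : R) : 0 < e -> lo <= c -> c + e <= hi ->
  \int[mu]_(t in `[lo, hi]) tent c e t = 1.
Proof.
move=> e0 loc chi; rewrite /Rintegral.
have lohi : lo < hi by lra.
have dr (t : R) : derivable (ramp c e) t 1 by exact: derivable_ramp.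
have cr : continuous (ramp c e).
  by move=> t; apply: differentiable_continuous; apply/derivable1_diffP; exact: dr.
rewrite (@continuous_FTC2 _ (tent c e) (ramp c e))//.
- by rewrite ramp_right// ramp_left//= subr0.
- by apply: continuous_subspaceT; exact: tent_continuous.
- split => [t _||]; first exact: dr.
    by apply: cvg_at_right_filter; exact: cr.
  by apply: cvg_at_left_filter; exact: cr.
- by move=> t _; exact: derive1_ramp.
Qed.

Lemma continuous_integrable_itv (lo hi : R) (h : R -> R) : continuous h ->
  mu.-integrable `[lo, hi] (EFin \o h).
Proof.
move=> ch; apply: continuous_compact_integrable; first exact: segment_compact.
exact: continuous_subspaceT.
Qed.

(** A tent is an approximate Dirac mass. *)
Lemma tent_sampling (g : R -> R) (c e lo hi L r : R) : 0 < e -> lo <= c -> c + e <= hi ->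
  continuous g ->
  (forall t, c <= t <= c + e -> `|g t - L| <= r) ->
  `|\int[mu]_(t in `[lo, hi]) (g t * tent c e t) - L| <= r.
Proof.
move=> e0 loc chi cg hg.
have ci := continuous_integrable_itv lo hi.
have ct : continuous (tent c e) by exact: tent_continuous.
have cgt : continuous (fun t => g t * tent c e t).
  by move=> t; apply: cvgM; [exact: cg|exact: ct].
have cLt (K : R) : continuous (fun t => K * tent c e t).
  by move=> t; apply: cvgM; [exact: cvg_cst|exact: ct].
have cgLt : continuous (fun t => g t * tent c e t - L * tent c e t).
  by move=> t; apply: cvgB; [exact: cgt|exact: cLt].
have m1 := @tent_integral c e lo hi e0 loc chi.
have -> : L = \int[mu]_(t in `[lo, hi]) (L * tent c e t).
  by rewrite RintegralZl ?m1 ?mulr1//; exact: ci.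
rewrite -RintegralB//; [|exact: ci|exact: ci].
apply: le_trans (le_normr_Rintegral _ _) _ => //; first exact: ci.
apply: (@le_trans _ _ (\int[mu]_(t in `[lo, hi]) (r * tent c e t))).
  apply: le_Rintegral => //; [|exact: ci|].
    apply: (ci (fun t => `|g t * tent c e t - L * tent c e t|)) => t.
    by apply: cvg_norm; exact: cgLt.
  move=> t _; rewrite -mulrBl normrM (ger0_norm (tent_ge0 _ _ e0)).
  have [tc|tc] := leP t c; first by rewrite tent_out ?mulr0//; left.
  have [ct'|ct'] := leP (c + e) t; first by rewrite tent_out ?mulr0//; right.
  by apply: ler_wpM2r; [exact: tent_ge0|apply: hg; rewrite !ltW].
by rewrite RintegralZl ?m1 ?mulr1//; exact: ci.
Qed.

Lemma Lfun2_integrable (g : R -> R) (T : R) :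
  (g \_ `[0, T]) \in Lfun mu 2%:E -> mu.-integrable `[0, T] (EFin \o g).
Proof.
move=> g2; have gs := Lfun2_integrable_sqr g2.
have : mu.-integrable `[0, T] (EFin \o (g \_ `[0, T])).
  have i1 : mu.-integrable `[0, T] (EFin \o (fun t => (g \_ `[0, T]) t ^+ 2 + 1)).
    have : mu.-integrable `[0, T] (fun t => ((g \_ `[0, T]) t ^+ 2)%:E + (1 : R)%:E)%E.
      apply: integrableD => //; first exact: integrableS gs.
      by apply: (@continuous_integrable_itv 0 T (cst 1)) => t; exact: cvg_cst.
    by [].
  apply: le_integrable i1 => //.
    apply/measurable_EFinP; move: g2; rewrite inE => /andP[mg _].
    by move: mg; rewrite inE => mg; exact: measurable_funTS.
  move=> t _ /=; rewrite lee_fin (ger0_norm (addr_ge0 (sqr_ge0 _) ler01)).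
  move: ((g \_ _) t) => s; rewrite ler_norml; apply/andP; split; nra.
apply: eq_integrable => // t /set_mem tT.
by rewrite /= patchT// inE.
Qed.

Lemma absolutely_continuous_modulus (m : nat) (T : R) (f : R -> 'rV[R]_m) :
  absolutely_continuous_vec T f ->
  forall e, 0 < e -> exists2 d, 0 < d & forall a b, 0 <= a -> a <= b -> b <= T ->
    b < a + d -> `|f b - f a| < e.
Proof.
move=> acf e /acf[d d0 hd]; exists d => // a b a0 ab bT bad.
apply: le_lt_trans (norm_le_enorm _) _.
have := hd 1%N (fun=> a) (fun=> b) _ _ _; rewrite !big_ord1; apply.
- by move=> _; split.
- apply/trivIsetP => i j _ _; by rewrite !ord1 eqxx.
- by rewrite ltrBlDl.
Qed.

(** Freezing the constraint outside of [[0, T]] lets the discrete evolutions run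
    for ever, with no case distinction at the last time step. *)
Definition clamp (T t : R) : R := Num.max 0 (Num.min T t).

Lemma clamp_itv (T t : R) : 0 <= T -> 0 <= clamp T t <= T.
Proof. by move=> T0; rewrite le_max lexx ge_max T0 ge_min lexx. Qed.

Lemma clamp_id (T t : R) : 0 <= t <= T -> clamp T t = t.
Proof. by move=> /andP[t0 tT]; rewrite /clamp (min_r tT) max_r. Qed.

Lemma clamp_le (T s t : R) : s <= t -> clamp T s <= clamp T t <= clamp T s + (t - s).
Proof.
move=> st; rewrite /clamp.
by case: (leP T s); case: (leP T t) => *; case: (leP 0 T); case: (leP 0 s);
  case: (leP 0 t) => *; apply/andP; split; lra.
Qed.

Lemma clamp_modulus (m : nat) (T : R) (f : R -> 'rV[R]_m) : 0 <= T ->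
  absolutely_continuous_vec T f ->
  forall e, 0 < e -> exists2 d, 0 < d & forall a b : R, a <= b -> b <= a + d ->
    `|f (clamp T b) - f (clamp T a)| <= e.
Proof.
move=> T0 /absolutely_continuous_modulus acf e /acf[d d0 hd].
exists (d / 2) => [|a b ab bad]; first by rewrite divr_gt0.
have /andP[h1 h2] := clamp_le T ab.
have /andP[h3 h4] := clamp_itv a T0; have /andP[h5 h6] := clamp_itv b T0.
by apply/ltW/hd => //; lra.
Qed.

Lemma clamp_continuous (m : nat) (T : R) (f : R -> 'rV[R]_m) j : 0 <= T ->
  absolutely_continuous_vec T f -> continuous (fun t => f (clamp T t) 0 j).
Proof.
move=> T0 /(clamp_modulus T0) acf t; apply: (@continuous_distP R R^o R^o) => e /acf[d d0 hd].
exists d => // s; rewrite ler_norml => /andP[h1 h2].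
have -> : f (clamp T t) 0 j - f (clamp T s) 0 j = (f (clamp T t) - f (clamp T s)) 0 j.
  by rewrite !mxE.
apply: le_trans (mx_coord_le _ _ _) _.
have [st|ts] := leP s t; first by apply: hd; lra.
by rewrite distrC; apply: hd; lra.
Qed.

(** The weak derivative is tested against C^1 cutoffs of [a, b]: the derivative
    of a cutoff samples [f] near the end points, while the cutoffs themselves
    tend to the indicator function of the open interval. *)
Lemma weak_derivative_ftc (m : nat) (T : R) (f df : R -> 'rV[R]_m) :
  0 < T -> W12 T f df -> forall j a b, 0 <= a -> a <= b -> b <= T ->
  f b 0 j - f a 0 j = \int[mu]_(t in `[a, b]) df t 0 j.
Proof.
move=> T0 [_ df2 wd acf] j a b a0; rewrite le_eqVlt => /predU1P[<- _|ab bT].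
  by rewrite subrr set_itv1 Rintegral_set1.
have idf := Lfun2_integrable (df2 0 j).
pose g t := f (clamp T t) 0 j.
have cg : continuous g by exact: clamp_continuous (ltW T0) acf.
(* At most a quarter of [b - a], so that the two ramps of [phi k] are disjoint. *)
pose e k : R := (b - a) / (k + 4)%:R.
have e0 k : 0 < e k by rewrite divr_gt0 ?subr_gt0// ltr0n addn_gt0 orbT.
have e4 k : 4 * e k <= b - a.
  rewrite /e mulrCA ler_piMr ?subr_ge0 ?(ltW ab)//.
  by rewrite ler_pdivrMr ?mul1r ?ler_nat ?leq_addl// ltr0n addn_gt0 orbT.
have ecvg : e k @[k --> \oo] --> 0.
  rewrite -(mulr0 (b - a)); apply: cvgMr.
  have -> : (fun k => (k + 4)%:R^-1) = (fun k => harmonic (k + 3)%N) :> (nat -> R).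
    by apply/funext => k; rewrite /harmonic addnS.
  by rewrite cvg_shiftn; exact: cvg_harmonic.
pose phi k t : R := ramp (a + e k) (e k) t - ramp (b - 2 * e k) (e k) t.
have dphi k (t : R) : is_derive (t : R) (1 : R) (phi k) (tent (a + e k) (e k) t - tent (b - 2 * e k) (e k) t).
  by apply: is_deriveB; exact: is_derive_ramp.
have d1phi k : derive1 (phi k) = (fun t => tent (a + e k) (e k) t - tent (b - 2 * e k) (e k) t).
  by apply/funext => t; rewrite derive1E; case: (dphi k t).
have out k t : t <= a + e k \/ b - e k <= t -> phi k t = 0.
  have := e4 k; have := e0 k => h1 h2 [h|h]; rewrite /phi.
    by rewrite !ramp_left ?subrr//; lra.
  by rewrite !ramp_right ?subrr//; lra.
have tphi k : test_function T (phi k).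
  split.
  - by move=> t; case: (dphi k t).
  - rewrite d1phi => t; apply: cvgB; exact: tent_continuous.
  - apply: (@subset_trans _ `[a + e k, b - e k]%classic).
      have /closure_id -> : closed `[a + e k, b - e k]%classic by exact: itv_closed.
      apply: closure_subset => t /= t0; rewrite in_itv/=; apply/andP; split; rewrite leNgt.
        by apply: contraNN t0 => h; apply/eqP/out; left; rewrite ltW.
      by apply: contraNN t0 => h; apply/eqP/out; right; rewrite ltW.
    move=> t /=; rewrite !in_itv/= => /andP[h1 h2].
    by have := e0 k; lra.
pose u k := \int[mu]_(t in `[0, T]) (f t 0 j * derive1 (phi k) t).
have uE k : u k = - \int[mu]_(t in `[0, T]) (df t 0 j * phi k t).
  by have := congr1 fine (wd _ (tphi k) j); rewrite fineN.
have cgt (c d : R) : mu.-integrable `[0, T] (EFin \o (fun t => g t * tent c d t)).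
  apply: continuous_integrable_itv => t.
  by apply: cvgM; [exact: cg|exact: tent_continuous].
have u1 k : u k = \int[mu]_(t in `[0, T]) (g t * tent (a + e k) (e k) t)
    - \int[mu]_(t in `[0, T]) (g t * tent (b - 2 * e k) (e k) t).
  rewrite -RintegralB//; apply: eq_Rintegral => t /set_mem /=.
  by rewrite in_itv/= => tT; rewrite d1phi -mulrBr /g clamp_id.
have sample (c : nat -> R) x : (forall k, 0 <= c k) -> (forall k, c k + e k <= T) ->
    c k @[k --> \oo] --> x ->
    \int[mu]_(t in `[0, T]) (g t * tent (c k) (e k) t) @[k --> \oo] --> g x.
  move=> c0 cT cx; apply/cvgrPdist_le => r r0.
  have /cvgrPdist_le /(_ _ r0) : g t @[t --> x] --> g x by exact: cg.
  move=> /(nbhs_normP) [d /= d0 hd].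
  near=> k; rewrite distrC; apply: tent_sampling => // t /andP[h1 h2].
  rewrite distrC; apply: hd => /=.
  have h3 : `|x - c k| < d / 2 by near: k; apply: cvgr_dist_lt => //; rewrite divr_gt0.
  have h4 : e k < d / 2 by near: k; apply: (cvgr_lt _ ecvg); rewrite divr_gt0.
  move: h3; rewrite ltr_norml => /andP[h5 h6]; rewrite ltr_norml; apply/andP; split; lra.
have ga : g a = f a 0 j by rewrite /g clamp_id// a0 (le_trans (ltW ab)).
have gb : g b = f b 0 j by rewrite /g clamp_id// bT (le_trans a0 (ltW ab)).
have lim1 : u k @[k --> \oo] --> f a 0 j - f b 0 j.
  rewrite -ga -gb; under eq_fun do rewrite u1; apply: cvgB; apply: sample.
  - by move=> k; have := e0 k; lra.
  - by move=> k; have := e0 k; have := e4 k; lra.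
  - by rewrite -[X in _ --> X]addr0; apply: cvgD => //; exact: cvg_cst.
  - by move=> k; have := e0 k; have := e4 k; lra.
  - by move=> k; have := e0 k; lra.
  - rewrite -[X in _ --> X]subr0; apply: cvgB; first exact: cvg_cst.
    by rewrite -(mulr0 2); apply: cvgMr.
pose h t := (df t 0 j) * (t \in `]a, b[)%:R.
have lim2 : (\int[mu]_(t in `[0, T]) (df t 0 j * phi k t)) @[k --> \oo] -->
    \int[mu]_(t in `[0, T]) h t.
  have mdf : measurable_fun `[0, T] (fun t => df t 0 j).
    by have /integrableP[/measurable_EFinP] := idf.
  have [] := @dominated_convergence _ _ _ mu `[0, T] _
    (fun k t => (df t 0 j * phi k t)%:E) (fun t => (h t)%:E) (fun t => `|(df t 0 j)%:E|%E).
  - exact: measurable_itv.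
  - move=> k; apply/measurable_EFinP; apply: measurable_funM => //.
    apply: measurable_funTS; apply: continuous_measurable_fun => t.
    by apply: differentiable_continuous; apply/derivable1_diffP; case: (dphi k t).
  - apply/measurable_EFinP; apply: measurable_funM => //.
    apply: measurable_funTS.
    rewrite (_ : (fun t => _) = \1_(`]a, b[%classic)); first exact: measurable_indic.
    by apply/funext => t; rewrite indicE mem_setE.
  - apply: aeW => t _; apply: cvg_EFin; first exact: nearW.
    apply: cvgMr; have [tab|tab] := boolP (t \in `]a, b[).
      have /andP[ta tb] : a < t < b by move: tab; rewrite in_itv.
      apply: cvg_near_cst; near=> k.
      have k1 : e k < (t - a) / 2 by near: k; apply: (cvgr_lt _ ecvg); rewrite divr_gt0 ?subr_gt0.
      have k2 : e k < (b - t) / 2 by near: k; apply: (cvgr_lt _ ecvg); rewrite divr_gt0 ?subr_gt0.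
      by rewrite /phi ramp_right ?ramp_left ?subr0//; lra.
    apply: cvg_near_cst; apply: nearW => k; apply: out; have := e0 k.
    move: tab; rewrite in_itv/= negb_and -!leNgt => /orP[h1|h1] h2; [left|right]; lra.
  - exact: integrable_abse.
  - apply: aeW => t k _ /=; rewrite lee_fin normrM ler_piMr//.
    have /andP[h1 h2] := ramp_itv (a + e k) t (e0 k).
    have /andP[h3 h4] := ramp_itv (b - 2 * e k) t (e0 k).
    by rewrite ler_norml /phi; apply/andP; split; lra.
  move=> ih _ lim; apply: fine_cvg; rewrite fineK//.
  by apply: integrable_fin_num => //; exact: measurable_itv.
have lim3 : u k @[k --> \oo] --> - \int[mu]_(t in `[0, T]) h t.
  by under eq_fun do rewrite uE; apply: cvgN.
have -> : \int[mu]_(t in `[a, b]) df t 0 j = \int[mu]_(t in `[0, T]) h t.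
  have idab : mu.-integrable `]a, b[ (EFin \o (fun t => df t 0 j)).
    apply: integrableS idf => //; apply: subset_itvW; rewrite ?bnd_simp//.
  rewrite -Rintegral_itv_obnd_cbnd; last first.
    apply: integrableS idf => //; apply: subset_itv; rewrite bnd_simp//.
  rewrite -Rintegral_itv_bndo_bndc//.
  have -> : `]a, b[%classic = `[0, T]%classic `&` `]a, b[%classic.
    apply/seteqP; split => t /=; rewrite !in_itv/=; last by case.
    by move=> /andP[h1 h2]; split => //; lra.
  rewrite Rintegral_mkcondr; apply: eq_Rintegral => t _.
  by rewrite /h patchE mem_setE; case: ifP; rewrite ?mulr1 ?mulr0.
have := cvg_lim (@Rhausdorff R) lim1; rewrite (cvg_lim (@Rhausdorff R) lim3) => E.
by rewrite -[LHS]opprB -E opprK.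
Unshelve. all: by end_near. Qed.

End weak_derivative_ftc.

(** * Helly's selection theorem *)

Section helly.
Context {R : realType}.

Lemma ultra_bounded_cvg (G : set_system nat) (u : nat -> R) (M : R) :
  UltraFilter G -> (forall k, `|u k| <= M) -> exists l : R, u k @[k --> G] --> l.
Proof.
move=> UG uM; have PG := @ultra_proper _ _ UG.
have cM : compact `[- M, M]%classic by exact: segment_compact.
have [|l [_ lc]] := cM (fmap u G) _.
  apply: (@filterE _ G) => k.
  by rewrite /preimage/= in_itv/= -ler_norml; exact: uM.
exists l => V lV; have [//|GV] := in_ultra_setVsetC (u @^-1` V) UG.
have [x [xV Vx]] := lc (~` V) V GV lV.
by case: xV.
Qed.

(** The one-sided approximation up to [e] can only fail at the smallest point
    where the monotone function [W] reaches a given level, or at the largest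
    point where it stays below it, and rational levels are enough. *)
Lemma monotone_sandwich (W : R -> R) : {homo W : s t / s <= t} ->
  exists D : nat -> R, forall t e, 0 < e ->
    exists i j, [/\ D i <= t, t <= D j & W (D j) - W (D i) < e].
Proof.
move=> ndW.
pose lo (c : rat) := get [set s | ratr c <= W s /\ forall s', ratr c <= W s' -> s <= s'].
pose hi (c : rat) := get [set s | W s <= ratr c /\ forall s', W s' <= ratr c -> s' <= s].
pose D' (x : rat + (rat + rat)) : R :=
  match x with inl r => ratr r | inr (inl c) => lo c | inr (inr c) => hi c end.
exists (fun n => oapp D' 0 (unpickle n)) => t e e0.
have e20 : 0 < e / 2 by rewrite divr_gt0.
have [x [xt Wx]] : exists x, D' x <= t /\ W t - W (D' x) < e / 2.
  have /rat_in_itvoo[c] : W t - e / 2 < W t by lra.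
  rewrite in_itv/= => /andP[c1 c2].
  have [ex|nex] := pselect (exists s, ratr c <= W s /\ forall s', ratr c <= W s' -> s <= s').
    have [h1 h2] := getPex ex; exists (inr (inl c)) => /=; rewrite -/(lo c) in h1 h2 *.
    by split; [apply: h2; exact: ltW|lra].
  have [s [cs st]] : exists s, ratr c <= W s /\ s < t.
    apply: contrapT => H; apply: nex; exists t; split; first exact: ltW.
    by move=> s' cs'; rewrite leNgt; apply/negP => s't; apply: H; exists s'.
  have /rat_in_itvoo[r] := st; rewrite in_itv/= => /andP[r1 r2].
  exists (inl r) => /=; split; first exact: ltW.
  by have := ndW _ _ (ltW r1); lra.
have [y [ty Wy]] : exists y, t <= D' y /\ W (D' y) - W t < e / 2.
  have /rat_in_itvoo[c] : W t < W t + e / 2 by lra.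
  rewrite in_itv/= => /andP[c1 c2].
  have [ex|nex] := pselect (exists s, W s <= ratr c /\ forall s', W s' <= ratr c -> s' <= s).
    have [h1 h2] := getPex ex; exists (inr (inr c)) => /=; rewrite -/(hi c) in h1 h2 *.
    by split; [apply: h2; exact: ltW|lra].
  have [s [cs st]] : exists s, W s <= ratr c /\ t < s.
    apply: contrapT => H; apply: nex; exists t; split; first exact: ltW.
    by move=> s' cs'; rewrite leNgt; apply/negP => s't; apply: H; exists s'.
  have /rat_in_itvoo[r] := st; rewrite in_itv/= => /andP[r1 r2].
  exists (inl r) => /=; split; first exact: ltW.
  by have := ndW _ _ (ltW r2); lra.
exists (pickle x), (pickle y); rewrite !pickleK/=; split => //; lra.
Qed.

(** Candidate limits are taken along an ultrafilter, simultaneously at all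
    times.  A subsequence realizes them on a countable set of times, and hence
    everywhere since increments are controlled by the monotone limit. *)
Lemma helly (I : finType) (V : nat -> R -> R) (g : I -> nat -> R -> R) (M : R) :
  (forall k, {homo V k : s t / s <= t}) ->
  (forall k t, `|V k t| <= M) -> (forall i k t, `|g i k t| <= M) ->
  (forall i k s t, s <= t -> `|g i k t - g i k s| <= V k t - V k s) ->
  exists (phi : nat -> nat) (W : R -> R) (l : I -> R -> R),
    [/\ forall j, (j <= phi j)%N,
        forall t, V (phi j) t @[j --> \oo] --> W t &
        forall i t, g i (phi j) t @[j --> \oo] --> l i t].
Proof.
move=> ndV VM gM gV.
pose h (i : option I) k t := if i is Some i' then g i' k t else V k t.
have hM i k t : `|h i k t| <= M by case: i => [i|]; [exact: gM|exact: VM].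
have hV i k s t : s <= t -> `|h i k t - h i k s| <= V k t - V k s.
  by move=> st; case: i => [i|] /=; [exact: gV|rewrite ger0_norm ?subr_ge0 ?ndV].
have [G [UG Gf]] : exists G : set_system nat, UltraFilter G /\ \oo `<=` G.
  exact: ultraFilterLemma.
have PG := @ultra_proper _ _ UG.
have /choice[L hL] : forall it : option I * R, exists l : R, h it.1 k it.2 @[k --> G] --> l.
  by move=> it; exact: ultra_bounded_cvg (hM _ ^~ _).
pose W t := L (None, t).
have VW t : V k t @[k --> G] --> W t by exact: hL (None, t).
have ndW : {homo W : s t / s <= t}.
  move=> s t st; apply: (ler_cvg_to (VW s) (VW t)); apply: filterE => k; exact: ndV.
have LW i s t : s <= t -> `|L (i, t) - L (i, s)| <= W t - W s.
  move=> st; apply: (@ler_cvg_to _ G _ _ (fun k => `|h i k t - h i k s|) (fun k => V k t - V k s)).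
  - by apply: cvg_norm; apply: cvgB; [exact: hL (i, t)|exact: hL (i, s)].
  - exact: cvgB.
  - by apply: filterE => k; exact: hV.
have [D hD] := monotone_sandwich ndW.
have /choice[phi hphi] : forall j : nat, exists k, (j <= k)%N /\
    forall (n : 'I_j.+1) i, `|L (i, D n) - h i k (D n)| < j.+1%:R^-1.
  move=> j; apply: (@filter_ex _ G); apply: filterI.
    by apply: Gf; exists j.
  apply: filter_forall => n; apply: filter_forall => i.
  apply: (@cvgr_dist_lt _ _ _ G _ _ _ (hL (i, D n))).
  by rewrite invr_gt0.
have cvg_h i t : h i (phi j) t @[j --> \oo] --> L (i, t).
  apply/cvgrPdist_le => e e0.
  have e4 : 0 < e / 8 by rewrite divr_gt0.
  have [a [b [Dat tDb Dab]]] := hD t _ e4.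
  near=> j.
  have ja : (a < j.+1)%N by rewrite ltnS; near: j; exact: nbhs_infty_ge.
  have jb : (b < j.+1)%N by rewrite ltnS; near: j; exact: nbhs_infty_ge.
  have je : j.+1%:R^-1 < e / 8 by near: j; exact: (near_infty_natSinv_lt (PosNum e4)).
  have [_ H] := hphi j.
  have := H (Ordinal ja) i; have := H (Ordinal ja) None; have := H (Ordinal jb) None.
  rewrite /= -/(W _) -/(W _); move=> h1 h2 h3.
  have h4 := hV i (phi j) _ _ Dat; have h5 := LW i _ _ Dat.
  have h6 := ndV (phi j) _ _ tDb; have h7 := ndW _ _ tDb.
  have h8 := ndV (phi j) _ _ Dat; have h9 := ndW _ _ Dat.
  have -> : L (i, t) - h i (phi j) t = (L (i, t) - L (i, D a)) +
     (L (i, D a) - h i (phi j) (D a)) - (h i (phi j) t - h i (phi j) (D a)) by ring.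
  apply: le_trans (ler_normB _ _) _; apply: le_trans (lerD (ler_normD _ _) (lexx _)) _.
  move: h1 h2; rewrite !ltr_norml => /andP[h1 h1'] /andP[h2 h2'].
  by move: je h3 h1 h1' h2 h2'; move: (j.+1%:R^-1) => r *; lra.
exists phi, W, (fun i t => L (Some i, t)); split.
- by move=> j; have [] := hphi j.
- by move=> t; exact: (cvg_h None).
- by move=> i t; exact: (cvg_h (Some i)).
Unshelve. all: by end_near. Qed.

End helly.

(** * Measurable selection of a cluster point *)

Section limsup_real.
Context {R : realType}.
Implicit Types (u : nat -> R) (x : R).

Lemma limn_esup_lt u x : (limn_esup (fun k => (u k)%:E) < x%:E)%E ->
  \forall k \near \oo, u k < x.
Proof.
move=> /ereal_inf_lt[_ [V Voo <-] Vx]; apply: filterS Voo => k Vk.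
by rewrite -lte_fin; apply: le_lt_trans Vx; apply: ereal_sup_ubound; exists k.
Qed.

Lemma limn_esup_gt u x : (x%:E < limn_esup (fun k => (u k)%:E))%E ->
  forall K, exists2 k, (K <= k)%N & x < u k.
Proof.
move=> xu K.
have KV : \oo [set k | (K <= k)%N] by exists K.
have : (x%:E < ereal_sup [set (u k)%:E | k in [set k | (K <= k)%N]])%E.
  by apply: lt_le_trans xu _; apply: ereal_inf_lbound; exists [set k | (K <= k)%N].
by move=> /ereal_sup_gt[_ [k Kk <-]]; rewrite lte_fin; exists k.
Qed.

Lemma limn_esup_le u x : (forall k, u k <= x) -> (limn_esup (fun k => (u k)%:E) <= x%:E)%E.
Proof.
move=> ux; apply: (@le_trans _ _ (ereal_sup [set (u k)%:E | k in setT])).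
  by apply: ereal_inf_lbound; exists setT => //; exact: filterT.
by apply: ge_ereal_sup => _ [k _ <-]; rewrite lee_fin.
Qed.

Lemma limn_esup_ge u x : (forall K, exists2 k, (K <= k)%N & x <= u k) ->
  (x%:E <= limn_esup (fun k => (u k)%:E))%E.
Proof.
move=> xu; apply: le_ereal_inf_tmp => _ [V [K _ KV] <-].
have [k Kk xk] := xu K; apply: (@le_trans _ _ (u k)%:E); first by rewrite lee_fin.
by apply: ereal_sup_ubound; exists k => //; exact: KV.
Qed.

End limsup_real.

Section cluster_selection.
Context {disp : measure_display} {T : measurableType disp} {R : realType}.
Variable D : set T.

(** Largest cluster value of [h] along the indices where [d] tends to [0]: the
    penalty [N d] discards the other indices when [N] tends to infinity. *)
Lemma measurable_penalized_limsup (d h : nat -> T -> R) :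
  (forall k, measurable_fun D (d k)) -> (forall k, measurable_fun D (h k)) ->
  (forall k t, 0 <= d k t) ->
  (forall t, D t -> forall (e : R) K, 0 < e -> exists2 k, (K <= k)%N & d k t < e) ->
  (forall t, D t -> exists B : R, forall k, `|h k t| <= B) ->
  exists H : T -> R, [/\ measurable_fun D H,
    forall t, D t -> forall (e : R) K, 0 < e ->
      exists2 k, (K <= k)%N & d k t + `|h k t - H t| < e &
    forall t, D t -> forall e, 0 < e -> exists N : nat,
      \forall k \near \oo, h k t < H t + e + N%:R * d k t].
Proof.
move=> md mh d0 dlim hB.
pose L (N : nat) t := limn_esup (fun k => (h k t - N%:R * d k t)%:E).
pose Hbar t := einfs (fun N => L N t) 0.
have HbarE t : Hbar t = ereal_inf (range (fun N => L N t)).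
  rewrite /Hbar /einfs /sdrop; congr ereal_inf; apply/seteqP.
  by split => _ [N _ <-]; exists N.
have mH : measurable_fun D (fun t => fine (Hbar t)).
  apply: measurableT_comp; first exact: fine_measurable.
  apply: measurable_fun_einfs => N; apply: measurable_fun_limn_esup => k.
  apply/measurable_EFinP; apply: measurable_funB => //.
  by apply: measurable_funM => //; exact: measurable_cst.
exists (fun t => fine (Hbar t)).
have fin t : D t -> Hbar t \is a fin_num.
  move=> Dt; have [B hb] := hB t Dt.
  have B1 : (Hbar t <= B%:E)%E.
    rewrite HbarE; apply: (@le_trans _ _ (L 0%N t)).
      by apply: ereal_inf_lbound; exists 0%N.
    apply: limn_esup_le => k; rewrite mul0r subr0.
    exact: le_trans (ler_norm _) (hb k).
  have B2 : ((- B - 1)%:E <= Hbar t)%E.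
    rewrite HbarE; apply: le_ereal_inf_tmp => _ [N _ <-].
    apply: limn_esup_ge => K.
    have [k Kk dk] := dlim t Dt _ K (divr_gt0 ltr01 (ltr0Sn R N)).
    exists k => //; have := hb k; rewrite ler_norml => /andP[h1 _].
    have : N%:R * d k t <= 1; last by lra.
    apply: (@le_trans _ _ (N.+1%:R * d k t)).
      by apply: ler_wpM2r => //; rewrite ler_nat.
    by rewrite mulrC -ler_pdivlMr// ltW.
  by rewrite fin_numElt (lt_le_trans _ B2) ?ltNyr// (le_lt_trans B1) ?ltry.
have HE t : D t -> Hbar t = (fine (Hbar t))%:E by move=> Dt; rewrite fineK ?fin.
have up t : D t -> forall e, 0 < e -> exists N : nat,
      \forall k \near \oo, h k t < fine (Hbar t) + e + N%:R * d k t.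
  move=> Dt e e0.
  have : (ereal_inf (range (fun N => L N t)) < (fine (Hbar t) + e)%:E)%E.
    by rewrite -HbarE {1}(HE t Dt) lte_fin ltrDl.
  move=> /ereal_inf_lt[_ [N _ <-]] /limn_esup_lt hN; exists N.
  by apply: filterS hN => k; rewrite ltrBlDr.
split => // t Dt e K e0.
have e6 : 0 < e / 6 by rewrite divr_gt0.
have [N [K' _ hN]] := up t Dt _ e6.
have : ((fine (Hbar t) - e / 6)%:E < L (2 * N.+1)%N t)%E.
  apply: (@lt_le_trans _ _ (Hbar t)); first by rewrite [ltRHS](HE t Dt) lte_fin; lra.
  by rewrite HbarE; apply: ereal_inf_lbound; exists (2 * N.+1)%N.
move=> /limn_esup_gt/(_ (maxn K K'))[k]; rewrite geq_max => /andP[Kk K'k] hk.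
exists k => //; have /= := hN k K'k; move: hk; rewrite natrM -(natr1 N).
have := d0 k t; have : 0 <= N%:R :> R by rewrite ler0n.
move: (N%:R) (d k t) (h k t) (fine (Hbar t)) => r dk hk Ht r0 dk0 h1 h2.
have rd : 0 <= r * dk by rewrite mulr_ge0.
have dk1 : r * dk + 2 * dk < 2 * (e / 6) by lra.
have : `|hk - Ht| < 3 * (e / 6) by rewrite ltr_norml; apply/andP; split; lra.
lra.
Qed.

(** The coordinates of the cluster point are selected one after the other, the
    first one being as large as possible. *)
Lemma measurable_cluster (h : nat -> nat -> T -> R) (p : nat) :
  (forall i k, measurable_fun D (h i k)) ->
  (forall i t, D t -> exists B : R, forall k, `|h i k t| <= B) ->
  exists H : nat -> T -> R, [/\ forall i, (i < p)%N -> measurable_fun D (H i),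
    forall t, D t -> forall (e : R) K, 0 < e -> exists2 k, (K <= k)%N &
      \sum_(i < p) `|h i k t - H i t| < e &
    (0 < p)%N -> forall t, D t -> forall e, 0 < e ->
      \forall k \near \oo, h 0%N k t < H 0%N t + e].
Proof.
move=> mh hB; elim: p => [|p [H [mH Hlim Hup]]].
  exists (fun _ _ => 0); split => // t Dt e K e0; exists K => //.
  by rewrite big_ord0.
have [||H' [mH' H'lim H'up]] := @measurable_penalized_limsup
    (fun k t => \sum_(i < p) `|h i k t - H i t|) (h p) _ (mh p) _ Hlim (hB p).
- move=> k; apply: measurable_sum => i; apply: measurableT_comp => //.
  by apply: measurable_funB => //; exact: mH.
- by move=> k t; apply: sumr_ge0.
exists (fun i => if i == p then H' else H i); split.
- move=> i; rewrite ltnS leq_eqVlt; case: eqP => //= _ ip; exact: mH.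
- move=> t Dt e K e0; have [k Kk hk] := H'lim t Dt e K e0.
  exists k => //; rewrite big_ord_recr/= eqxx.
  by under eq_bigr do rewrite ltn_eqF//.
- move=> _ t Dt e e0; case: (posnP p) => [p0|p0]; last first.
    by rewrite ltn_eqF//; exact: Hup.
  rewrite p0 eqxx; have [N] := H'up t Dt e e0.
  apply: filterS => k; rewrite p0 big_ord0 mulr0 addr0//.
Qed.

End cluster_selection.

(** * The constraint as a function on the half-line *)

Lemma measurable_duality (d : measure_display) (S : measurableType d) (R : realType)
    (k : nat) (D : set S) (q : S -> 'cV[R]_k) (g : S -> 'rV[R]_k) :
  (forall j, measurable_fun D (fun s => q s j 0)) ->
  (forall j, measurable_fun D (fun s => g s 0 j)) ->
  measurable_fun D (fun s => duality (q s) (g s)).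
Proof.
move=> mq mg; rewrite (_ : (fun s => _) = (fun s => \sum_j g s 0 j * q s j 0)).
  by apply: measurable_sum => j; apply: measurable_funM.
by apply/funext => s; rewrite dualityE.
Qed.

Section Rintegral_complements.
Context {R : realType}.
Notation mu := (@lebesgue_measure R).

Lemma Rintegral_sum (D : set R) (I : Type) (r : seq I) (h : I -> R -> R) :
  measurable D -> (forall i, mu.-integrable D (EFin \o h i)) ->
  mu.-integrable D (EFin \o (fun s => \sum_(i <- r) h i s)) /\
  \int[mu]_(s in D) (\sum_(i <- r) h i s) = \sum_(i <- r) \int[mu]_(s in D) h i s.
Proof.
move=> mD ih; elim: r => [|i r [IH1 IH2]].
  have i0 : mu.-integrable D (EFin \o (fun=> 0)) by exact: integrable0.
  rewrite (_ : (fun s => _) = (fun=> 0)); last by apply/funext => s; rewrite big_nil.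
  split=> //.
  by rewrite big_nil Rintegral_cst// mul0r.
rewrite (_ : (fun s => _) = (fun s => h i s + \sum_(j <- r) h j s)); last first.
  by apply/funext => s; rewrite big_cons.
have hD : mu.-integrable D (fun s => (h i s)%:E + (\sum_(j <- r) h j s)%:E)%E.
  by apply: integrableD => //; exact: ih.
split; first exact: hD.
by rewrite RintegralD// IH2 big_cons.
Qed.

Lemma integrable_scale (D : set R) (c : R) (h : R -> R) : measurable D ->
  mu.-integrable D (EFin \o h) -> mu.-integrable D (EFin \o (fun s => c * h s)).
Proof.
move=> mD ih; have hD : mu.-integrable D (fun s => c%:E * (h s)%:E)%E.
  exact: integrableZl.
exact: hD.
Qed.

Lemma integrable_itv_sub (T a b : R) (h : R -> R) : 0 <= a -> b <= T ->
  mu.-integrable `[0, T] (EFin \o h) -> mu.-integrable `[a, b] (EFin \o h).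
Proof.
move=> a0 bT ih; apply: integrableS ih => //.
by apply: subset_itv; rewrite bnd_simp.
Qed.

Lemma Rintegral_itv_sub (T a b : R) (h : R -> R) : 0 <= a -> a <= b -> b <= T ->
  mu.-integrable `[0, T] (EFin \o h) ->
  \int[mu]_(s in `[0, b]) h s - \int[mu]_(s in `[0, a]) h s = \int[mu]_(s in `[a, b]) h s.
Proof.
move=> a0 ab bT ih; rewrite Rintegral_itvB ?bnd_simp//.
- rewrite Rintegral_itv_obnd_cbnd//; apply: integrableS ih => //.
  by apply: subset_itv; rewrite bnd_simp.
- by apply: integrable_itv_sub ih.
Qed.

End Rintegral_complements.

Section constraint.
Context {R : realType} {m : nat}.
Notation mu := (@lebesgue_measure R).
Variables (T : R) (f df : R -> 'rV[R]_m).
Hypotheses (T0 : 0 < T) (hf : W12 T f df).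

Let speed (s : R) : R := \sum_j `|df s 0 j|.

Lemma derivative_integrable j : mu.-integrable `[0, T] (EFin \o (fun s => df s 0 j)).
Proof. by apply: Lfun2_integrable; case: hf => _ h _ _; exact: h. Qed.

Lemma measurable_derivative j : measurable_fun `[0, T] (fun s => df s 0 j).
Proof. by have /integrableP[/measurable_EFinP] := derivative_integrable j. Qed.

Lemma speed_integrable : mu.-integrable `[0, T] (EFin \o speed).
Proof.
have [//||h _] := @Rintegral_sum _ `[0, T]%classic _ (index_enum 'I_m) (fun j s => `|df s 0 j|).
- move=> j; exact: integrable_abse (derivative_integrable j).
- exact: h.
Qed.

(** An arc length of the constraint, for the l^1 norm of its derivative. *)
Definition clamp_length (t : R) : R := \int[mu]_(s in `[0, clamp T t]) speed s.

Lemma clamp_length_le (a b : R) : a <= b ->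
  `|f (clamp T b) - f (clamp T a)| <= clamp_length b - clamp_length a.
Proof.
move=> ab; have /andP[cab _] := clamp_le T ab.
have /andP[a0 aT] := clamp_itv a (ltW T0); have /andP[b0 bT] := clamp_itv b (ltW T0).
rewrite /clamp_length (@Rintegral_itv_sub _ T)//; last exact: speed_integrable.
have isp := integrable_itv_sub a0 bT speed_integrable.
apply: mx_norm_le => [|i j]; first by apply: Rintegral_ge0 => s _; exact: sumr_ge0.
have idf := integrable_itv_sub a0 bT (derivative_integrable j).
rewrite ord1 !mxE (weak_derivative_ftc T0 hf)//.
apply: le_trans (le_normr_Rintegral _ idf) _ => //.
apply: le_Rintegral => //; first exact: integrable_abse idf.
by move=> s _; rewrite /speed (bigD1 j)//= lerDl sumr_ge0.
Qed.

Lemma clamp_length_bounded (t : R) : clamp_length t - clamp_length 0 <= clamp_length T.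
Proof.
have /andP[t0 tT] := clamp_itv t (ltW T0).
have -> : clamp_length 0 = 0.
  by rewrite /clamp_length clamp_id ?lexx ?ltW// set_itv1 Rintegral_set1.
have cT : clamp T T = T by rewrite clamp_id// lexx (ltW T0).
rewrite subr0 -subr_ge0 /clamp_length cT.
rewrite (@Rintegral_itv_sub _ T)//; last exact: speed_integrable.
by apply: Rintegral_ge0 => s _; exact: sumr_ge0.
Qed.

Lemma duality_derivative_le (q : 'cV[R]_m) (s M : R) : (forall j, `|q j 0| <= M) ->
  `|duality q (df s)| <= M * speed s.
Proof.
move=> qM; rewrite dualityE (le_trans (ler_norm_sum _ _ _))// mulr_sumr.
by apply: ler_sum => j _; rewrite normrM mulrC; apply: ler_wpM2r.
Qed.

Lemma Rintegral_duality_derivative (q : 'cV[R]_m) (a b : R) : 0 <= a -> a <= b -> b <= T ->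
  \int[mu]_(s in `[a, b]) duality q (df s) = duality q (f b - f a).
Proof.
move=> a0 ab bT.
have idf j : mu.-integrable `[a, b] (EFin \o (fun s => df s 0 j * q j 0)).
  rewrite (_ : (fun s => _) = (fun s => q j 0 * df s 0 j)); last first.
    by apply/funext => s; rewrite mulrC.
  by apply: integrable_scale => //; exact: integrable_itv_sub (derivative_integrable j).
under eq_Rintegral do rewrite dualityE.
have [//|_ ->] := @Rintegral_sum _ `[a, b]%classic _ (index_enum 'I_m)
  (fun j s => df s 0 j * q j 0) _ idf.
rewrite dualityE; apply: eq_bigr => j _.
rewrite RintegralZr//; last exact: integrable_itv_sub (derivative_integrable j).
by rewrite !mxE (weak_derivative_ftc T0 hf).
Qed.

End constraint.

(** * Step functions *)

Section step_function.
Context {R : realType}.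
Variable delta : R.
Hypothesis delta0 : 0 < delta.

(** Negative times have index [0], as the initial value on [[- delta, 0]]
    requires. *)
Definition step_index (t : R) : nat := Num.truncn (t / delta).

Lemma step_index_le (s t : R) : s <= t -> (step_index s <= step_index t)%N.
Proof. by move=> st; apply: le_truncn; rewrite ler_pM2r// invr_gt0. Qed.

Lemma step_index_cell (i : nat) (t : R) :
  i%:R * delta <= t < i.+1%:R * delta -> step_index t = i.
Proof.
move=> /andP[it ti]; apply: truncn_def.
by rewrite ler_pdivlMr// ltr_pdivrMr// it ti.
Qed.

Lemma step_index_itv (t : R) : 0 <= t ->
  (step_index t)%:R * delta <= t < (step_index t).+1%:R * delta.
Proof.
move=> t0; rewrite -ler_pdivlMr// -ltr_pdivrMr//; apply: truncn_itv.
by rewrite divr_ge0// ltW.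
Qed.

Lemma step_index0 (t : R) : t < delta -> step_index t = 0%N.
Proof.
by move=> td; apply/eqP; rewrite -leqn0 truncn_le_nat ltr_pdivrMr// mul1r.
Qed.

Lemma step_index_right (t : R) : \forall s \near t^'+, step_index s = step_index t.
Proof.
have h : t < (step_index t).+1%:R * delta.
  by rewrite -ltr_pdivrMr//; exact: truncnS_gt.
near=> s; apply/eqP; rewrite eqn_leq; apply/andP; split.
  by rewrite truncn_le_nat ltr_pdivrMr//; near: s; exact: nbhs_right_lt.
by apply: step_index_le; near: s; exact: nbhs_right_ge.
Unshelve. all: by end_near. Qed.

Lemma measurable_step (u : nat -> R) (D : set R) : measurable D ->
  measurable_fun D (fun t => u (step_index t)).
Proof.
move=> mD _ Y mY.
have -> : (fun t => u (step_index t)) @^-1` Y =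
   \bigcup_(i in [set i | Y (u i)]) (step_index @^-1` [set i]).
  apply/seteqP; split => [t Yt|t [i Yi] /= ->//].
  by exists (step_index t).
apply: measurableI => //; apply: bigcup_measurable => i _.
have lei (k : nat) : measurable [set t : R | (step_index t <= k)%N].
  have -> : [set t | (step_index t <= k)%N] = `]-oo, (k.+1%:R * delta)[%classic.
    by apply/seteqP; split => t /=; rewrite in_itv/= truncn_le_nat ltr_pdivrMr.
  exact: measurable_itv.
case: i => [|i].
  have -> : step_index @^-1` [set 0%N] = [set t | (step_index t <= 0)%N].
    by apply/seteqP; split => t /=; rewrite leqn0 => /eqP.
  exact: lei.
have -> : step_index @^-1` [set i.+1] = [set t | (step_index t <= i.+1)%N] `\`
    [set t | (step_index t <= i)%N].
  apply/seteqP; split => t /=; first by move=> ->; split => //; rewrite ltnn.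
  by move=> [h1 /negP h2]; apply/eqP; rewrite eqn_leq h1 ltnNge.
by apply: measurableD; exact: lei.
Qed.

End step_function.

(** * Energy inequality at arbitrary times *)

Section discrete_energy.
Context {R : realType} {n m : nat}.
Notation mu := (@lebesgue_measure R).
Variables (A : 'M[R]_(n, m)) (J psi : 'rV[R]_n -> R) (eta : R) (v0 : 'rV[R]_n).
Variables (T : R) (f df : R -> 'rV[R]_m).
Hypotheses (T0 : 0 < T) (hf : W12 T f df).
Variables (M delta : R) (x y : nat -> 'rV[R]_n) (q : nat -> 'cV[R]_m)
  (kappa : nat -> 'cV[R]_n).
Hypotheses (delta0 : 0 < delta)
  (ds : discrete_solution A J psi eta v0 (fun t => f (clamp T t)) M delta x y q kappa).

Let idx := step_index delta.
Let power s := duality (q (idx s)) (df s).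
Let work l := duality (q l) (f (clamp T (l.+1%:R * delta)) - f (clamp T (l%:R * delta))).

(** The proximal terms are counted besides the dissipated energy, so that the
    increments also control the distance from [x l] to [y l]. *)
Definition dissipation (i : nat) : R :=
  \sum_(l < i) (psi (x l.+1 - x l) + eta * enorm (y l - x l) ^+ 2).

Lemma measurable_step_entry (k : nat) (u : nat -> 'cV[R]_k) j (D : set R) :
  measurable D -> measurable_fun D (fun s => u (step_index delta s) j 0).
Proof. by move=> mD; exact: (measurable_step delta0 (fun i => u i j 0)). Qed.

Lemma power_integrable : mu.-integrable `[0, T] (EFin \o power).
Proof.
have M0 : 0 <= M by exact: le_trans (ds_bounded ds 0).
have isp : mu.-integrable `[0, T] (EFin \o (fun s => M * \sum_j `|df s 0 j|)).
  by apply: integrable_scale => //; exact: speed_integrable hf.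
apply: le_integrable isp => //.
  apply/measurable_EFinP; apply: measurable_duality => j.
    exact: measurable_step_entry.
  exact: (measurable_derivative hf).
move=> s _ /=; rewrite lee_fin.
apply: le_trans (duality_derivative_le _ _ (ds_multiplier ds _)) _.
by rewrite ler_norm.
Qed.

Lemma power_cell (l : nat) (a b : R) : l%:R * delta <= a -> a <= b ->
  b <= l.+1%:R * delta -> b <= T ->
  \int[mu]_(s in `[a, b]) power s = duality (q l) (f b - f a).
Proof.
move=> la ab bl bT.
have a0 : 0 <= a by apply: le_trans la; rewrite mulr_ge0// ltW.
rewrite -(Rintegral_duality_derivative T0 hf)//.
have bndo (h : R -> R) : mu.-integrable `[0, T] (EFin \o h) ->
    \int[mu]_(s in `[a, b]) h s = \int[mu]_(s in `[a, b[) h s.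
  move=> ih; rewrite Rintegral_itv_bndo_bndc//; apply: integrableS ih => //.
  by apply: subset_itv; rewrite bnd_simp.
rewrite !bndo//.
- apply: eq_Rintegral => s /set_mem/=; rewrite in_itv/= => /andP[as_ sb].
  by rewrite /power /idx (step_index_cell delta0 (i := l))// (le_trans la)//= (lt_le_trans sb).
- have isp : mu.-integrable `[0, T] (EFin \o (fun s => M * \sum_j `|df s 0 j|)).
    by apply: integrable_scale => //; exact: speed_integrable hf.
  apply: le_integrable isp => //.
    apply/measurable_EFinP; apply: measurable_duality => j; first exact: measurable_cst.
    exact: (measurable_derivative hf).
  move=> s _ /=; rewrite lee_fin.
  by apply: le_trans (duality_derivative_le _ _ (ds_multiplier ds _)) _; rewrite ler_norm.
- exact: power_integrable.
Qed.

Lemma power_primitive (i : nat) (t : R) : i%:R * delta <= t <= i.+1%:R * delta -> t <= T ->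
  \int[mu]_(s in `[0, t]) power s =
  \sum_(l < i) work l + duality (q i) (f t - f (i%:R * delta)).
Proof.
elim: i t => [|i IH] t /andP[it ti] tT.
  by rewrite big_ord0 add0r -(power_cell (l := 0))// mul0r.
have i0 : 0 <= i%:R * delta by rewrite mulr_ge0// ltW.
have ii : i%:R * delta <= i.+1%:R * delta by rewrite ler_pM2r// ler_nat.
have := IH (i.+1%:R * delta); rewrite ii lexx (le_trans it tT) => /(_ isT isT) h.
have := Rintegral_itv_sub (le_trans i0 ii) it tT power_integrable.
move/eqP; rewrite subr_eq => /eqP ->.
rewrite h (power_cell (l := i.+1))// big_ord_recr/= /work !clamp_id.
- exact: addrC.
- by rewrite i0 (le_trans ii)// (le_trans it).
- by rewrite (le_trans i0 ii) (le_trans it).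
Qed.

Lemma energy_nonincreasing (i j : nat) : (i <= j)%N ->
  J (x j) + dissipation j - \sum_(l < j) work l <=
  J (x i) + dissipation i - \sum_(l < i) work l.
Proof.
move=> /subnK <-; elim: (j - i)%N => // k IH; apply: le_trans IH.
rewrite addSn /dissipation !big_ord_recr/=; have := ds_energy ds (k + i)%N.
rewrite -/(work _); lra.
Qed.

(** Between [t1] and [t2] the work differs from the sum over full steps by two
    incomplete steps, during which the constraint moves by at most [w]. *)
Lemma discrete_energy (w t1 t2 : R) : 0 <= t1 -> t1 <= t2 -> t2 <= T ->
  (forall a b : R, a <= b -> b <= a + delta -> `|f (clamp T b) - f (clamp T a)| <= w) ->
  J (x (idx t2)) + (dissipation (idx t2) - dissipation (idx t1)) <=
  J (x (idx t1)) + \int[mu]_(s in `[t1, t2]) power s + 2 * (m%:R * M * w).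
Proof.
move=> t10 t12 t2T hw; have t20 := le_trans t10 t12; have t1T := le_trans t12 t2T.
have M0 : 0 <= M by exact: le_trans (ds_bounded ds 0).
have part t : 0 <= t -> t <= T ->
    `|duality (q (idx t)) (f t - f ((idx t)%:R * delta))| <= m%:R * M * w.
  move=> t0 tT; have /andP[h1 h2] := step_index_itv delta0 t0.
  apply: le_trans (duality_le _ (ds_multiplier ds _)) _.
  apply: ler_wpM2l; first by rewrite mulr_ge0.
  have i0 : 0 <= (idx t)%:R * delta by rewrite mulr_ge0// ltW.
  have := hw _ _ h1; rewrite !clamp_id ?i0 ?t0 ?(le_trans h1)//; apply.
  by move: h2; rewrite -natr1 mulrDl mul1r => /ltW.
have prim t : 0 <= t -> t <= T -> \int[mu]_(s in `[0, t]) power s =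
    \sum_(l < idx t) work l + duality (q (idx t)) (f t - f ((idx t)%:R * delta)).
  move=> t0 tT; apply: power_primitive => //.
  by have /andP[h1 h2] := step_index_itv delta0 t0; rewrite h1 ltW.
have := energy_nonincreasing (step_index_le delta0 t12).
rewrite -(Rintegral_itv_sub t10 t12 t2T power_integrable) !prim// -/idx.
have := part _ t10 t1T; have := part _ t20 t2T; rewrite !ler_norml.
by move=> /andP[h1 h2] /andP[h3 h4]; lra.
Qed.

End discrete_energy.

(** * Limits of rows, forms and subgradients *)

Section vector_limits.
Context {R : realType}.

Lemma cvg_seq_sum (I : Type) (r : seq I) (u : I -> nat -> R) (l : I -> R) :
  (forall i, u i k @[k --> \oo] --> l i) ->
  (\sum_(i <- r) u i k) @[k --> \oo] --> \sum_(i <- r) l i.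
Proof.
move=> ul; elim: r => [|i r IH].
  by under eq_fun do rewrite big_nil; rewrite big_nil; exact: cvg_cst.
by under eq_fun do rewrite big_cons; rewrite big_cons; apply: cvgD; [exact: ul|exact: IH].
Qed.

Lemma row_cvg (n : nat) (u : nat -> 'rV[R]_n) (v : 'rV[R]_n) :
  (forall j, u k 0 j @[k --> \oo] --> v 0 j) -> u k @[k --> \oo] --> v.
Proof.
move=> uv; apply/cvgrPdist_le => e e0.
have : \forall k \near \oo, forall j, `|v 0 j - u k 0 j| <= e.
  by apply: filter_forall => j; apply: cvgr_dist_le => //; exact: uv.
apply: filterS => k h; apply: mx_norm_le => [|i j]; first exact: ltW.
by rewrite ord1 !mxE.
Qed.

Lemma row_cvg_coord (n : nat) (u : nat -> 'rV[R]_n) (v : 'rV[R]_n) j :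
  u k @[k --> \oo] --> v -> u k 0 j @[k --> \oo] --> v 0 j.
Proof.
by move=> uv; exact: (@cvg_comp _ _ _ u (fun w : 'rV[R]_n => w 0 j) _ _ _ uv
  (@coord_continuous R 1 n 0 j v)).
Qed.

Lemma continuous_seq (n : nat) (g : 'rV[R]_n -> R) (u : nat -> 'rV[R]_n) (v : 'rV[R]_n) :
  continuous g -> u k @[k --> \oo] --> v -> g (u k) @[k --> \oo] --> g v.
Proof. by move=> cg uv; exact: (@cvg_comp _ _ _ u g _ _ _ uv (cg v)). Qed.

Lemma duality_cvg (n : nat) (zeta : nat -> 'cV[R]_n) (zeta0 : 'cV[R]_n)
    (u : nat -> 'rV[R]_n) (v : 'rV[R]_n) :
  (forall j, zeta k j 0 @[k --> \oo] --> zeta0 j 0) -> u k @[k --> \oo] --> v ->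
  duality (zeta k) (u k) @[k --> \oo] --> duality zeta0 v.
Proof.
move=> zz uv; rewrite dualityE; under eq_fun do rewrite dualityE.
by apply: cvg_seq_sum => j; apply: cvgM; [exact: row_cvg_coord|exact: zz].
Qed.

(** Subgradients with a quadratic defect pass to the limit, since the defect
    has the same constant along the sequence. *)
Lemma subgradient_limit (n : nat) (J : 'rV[R]_n -> R) (eta : R)
    (y : nat -> 'rV[R]_n) (v : 'rV[R]_n) (zeta : nat -> 'cV[R]_n) (zeta0 : 'cV[R]_n) :
  continuous J -> y k @[k --> \oo] --> v ->
  (forall j, zeta k j 0 @[k --> \oo] --> zeta0 j 0) ->
  (forall k w, J (y k) + duality (zeta k) (w - y k) - eta * enorm (w - y k) ^+ 2 <= J w) ->
  forall w, J v + duality zeta0 (w - v) - eta * enorm (w - v) ^+ 2 <= J w.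
Proof.
move=> cJ yv zz sub w.
have wy : (w - y k) @[k --> \oo] --> w - v.
  apply: row_cvg => j; rewrite !mxE; under eq_fun do rewrite !mxE.
  by apply: cvgB; [exact: cvg_cst|exact: row_cvg_coord].
apply: (@ler_cvg_to _ \oo _ _ _ (fun=> J w)); last exact: nearW (sub ^~ w).
  apply: cvgB; last by apply: cvgMr; exact: (continuous_seq (@enorm_sqr_continuous R n) wy).
  by apply: cvgD; [exact: continuous_seq|exact: duality_cvg].
exact: cvg_cst.
Qed.

End vector_limits.

Section vector_selection.
Context {disp : measure_display} {S : measurableType disp} {R : realType}.
Variable D : set S.

(** The pairing is treated as a coordinate ahead of the others, so that its
    largest cluster value is selected; by continuity this value is the pairing
    with the selected cluster point. *)
Lemma measurable_cluster_vec (N : nat) (z : nat -> S -> 'cV[R]_N) (g : S -> 'rV[R]_N)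
    (M : R) :
  (forall k j, measurable_fun D (fun s => z k s j 0)) ->
  (forall j, measurable_fun D (fun s => g s 0 j)) ->
  (forall k s j, `|z k s j 0| <= M) ->
  exists Z : S -> 'cV[R]_N, [/\ forall j, measurable_fun D (fun s => Z s j 0),
    forall s, D s -> forall (e : R) K, 0 < e ->
      exists2 k, (K <= k)%N & forall j, `|z k s j 0 - Z s j 0| < e,
    forall s, D s -> forall e, 0 < e ->
      \forall k \near \oo, duality (z k s) (g s) < duality (Z s) (g s) + e &
    forall s, D s -> forall j, `|Z s j 0| <= M].
Proof.
move=> mz mg zM.
pose h (i k : nat) s : R := if i is i'.+1 then
  (if insub i' is Some j then z k s j 0 else 0) else duality (z k s) (g s).
have [|i s Ds|H [mH Hlim Hup]] := measurable_cluster (D := D) (h := h) N.+1.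
- move=> [|i] k /=; first exact: measurable_duality.
  by rewrite /h; case: (insub i : option 'I_N) => [j|]; [exact: mz|exact: measurable_cst].
- case: i => [|i] /=.
    exists (N%:R * M * `|g s|) => k; apply: duality_le => j; exact: zM.
  exists `|M| => k; rewrite /h; case: (insub i : option 'I_N) => [j|]; last by rewrite normr0.
  exact: le_trans (zM _ _ _) (ler_norm _).
pose Z s : 'cV[R]_N := \col_j H j.+1 s.
have cl s : D s -> forall (e : R) K, 0 < e -> exists2 k, (K <= k)%N &
    `|duality (z k s) (g s) - H 0%N s| < e /\ forall j, `|z k s j 0 - Z s j 0| < e.
  move=> Ds e K e0; have [k Kk hk] := Hlim s Ds e K e0; exists k => //.
  have le i : (i < N.+1)%N -> `|h i k s - H i s| < e.
    move=> iN; apply: le_lt_trans hk.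
    by rewrite (bigD1 (Ordinal iN))//= lerDl sumr_ge0.
  split; first exact: (le 0%N).
  by move=> j; rewrite mxE; have := le j.+1 (ltn_ord j); rewrite /h valK.
have H0 s : D s -> H 0%N s <= duality (Z s) (g s).
  move=> Ds; apply/ler_addgt0Pr => e e0.
  have c0 : 0 < 1 + N%:R * `|g s| by rewrite ltr_pwDl// mulr_ge0.
  have ec0 : 0 < e / (1 + N%:R * `|g s|) by rewrite divr_gt0.
  have [k _ [h1 h2]] := cl s Ds _ 0%N ec0.
  have : `|duality (z k s - Z s) (g s)| <= N%:R * (e / (1 + N%:R * `|g s|)) * `|g s|.
    by apply: duality_le => j; rewrite !mxE ltW//; have := h2 j; rewrite !mxE.
  have : e / (1 + N%:R * `|g s|) * (1 + N%:R * `|g s|) = e by rewrite divfK// gt_eqF.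
  move: h1; rewrite dualityDl dualityNl.
  move: (e / _) => r; rewrite ltr_norml ler_norml => /andP[h3 h4] h5 /andP[h6 h7].
  nra.
exists Z; split.
- move=> j; rewrite (_ : (fun s => Z s j 0) = H j.+1); first exact: (mH j.+1 (ltn_ord j)).
  by apply/funext => s; rewrite mxE.
- by move=> s Ds e K e0; have [k Kk [_ h2]] := cl s Ds e K e0; exists k.
- move=> s Ds e e0; have := Hup isT s Ds e e0; apply: filterS => k /= hk.
  by apply: lt_le_trans hk _; rewrite lerD2r; exact: H0.
- move=> s Ds j; apply/ler_addgt0Pr => e e0.
  have [k _ [_ h2]] := cl s Ds _ 0%N e0.
  have := zM k s j; have := h2 j; rewrite !ltr_norml !ler_norml.
  by move=> /andP[h3 h4] /andP[h5 h6]; apply/andP; split; lra.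
Qed.

End vector_selection.

(** At different points where a monotone function jumps to the right, the jumps
    are over disjoint intervals of values, each of which contains a rational. *)
Lemma right_jumps_negligible (R : realType) (W : R -> R) : {homo W : s t / s <= t} ->
  (@lebesgue_measure R).-negligible
    [set t | exists2 e, 0 < e & forall s, t < s -> e <= W s - W t].
Proof.
move=> ndW; set N := [set t | _].
have /choice[r hr] : forall t, exists r : rat, N t ->
    W t < ratr r /\ forall s, t < s -> ratr r < W s.
  move=> t; have [[e e0 he]|nN] := pselect (N t); last by exists 0.
  have /rat_in_itvoo[r] : W t < W t + e by rewrite ltrDl.
  rewrite in_itv/= => /andP[r1 r2]; exists r => _; split => // s ts.
  by have := he s ts; lra.
have cN : countable N.
  apply/countable_injP; exists (pickle \o r) => s t /set_mem Ns /set_mem Nt /=.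
  move=> /(pcan_inj pickleK) rst.
  have [s1 s2] := hr s Ns; have [t1 t2] := hr t Nt.
  have [st|ts|//] := ltgtP s t.
    by have := s2 t st; rewrite rst ltNge ltW.
  by have := t2 s ts; rewrite -rst ltNge ltW.
apply/negligibleP; last exact: countable_lebesgue_measure0.
by apply: countable_measurable => // t; exact: measurable_set1.
Qed.

(** * Passage to the limit *)

Section partition_sums.
Context {R : realType} {n : nat}.
Variables (psi : 'rV[R]_n -> R) (eta : R).
Hypotheses (psi_ge0 : forall v, 0 <= psi v) (P1 : Psi1 psi) (P2 : Psi2 psi).
Hypothesis eta_ge0 : 0 <= eta.
Variables (x y : nat -> 'rV[R]_n).

Lemma dissipation_le (i j : nat) : (i <= j)%N ->
  dissipation psi eta x y i <= dissipation psi eta x y j.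
Proof.
move=> /subnK <-; elim: (j - i)%N => // k IH; apply: le_trans IH _.
by rewrite addSn /dissipation big_ord_recr/= lerDl addr_ge0// mulr_ge0// sqr_ge0.
Qed.

Lemma gauge_dissipation (i j : nat) : (i <= j)%N ->
  psi (x j - x i) <= dissipation psi eta x y j - dissipation psi eta x y i.
Proof.
move=> /subnK <-; elim: (j - i)%N => [|k IH].
  by rewrite add0n !subrr (P1 0).2.
rewrite addSn [dissipation _ _ _ _ (k + i).+1]/dissipation big_ord_recr/=.
rewrite -/(dissipation psi eta x y (k + i)).
have := P2 (x (k + i).+1 - x (k + i)%N) (x (k + i)%N - x i); rewrite subrKA.
have : 0 <= eta * enorm (y (k + i)%N - x (k + i)%N) ^+ 2 by rewrite mulr_ge0// sqr_ge0.
lra.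
Qed.

Lemma partition_dissipation (delta a b : R) (s : seq R) : 0 < delta ->
  itv_partition a b s ->
  \sum_(0 <= i < size s) psi (x (step_index delta (nth b (a :: s) i.+1)) -
    x (step_index delta (nth b (a :: s) i))) <=
  dissipation psi eta x y (step_index delta b) - dissipation psi eta x y (step_index delta a).
Proof.
move=> delta0 [ps lasts]; pose p i := step_index delta (nth b (a :: s) i).
rewrite -/(p _); under eq_bigr do rewrite -/(p _) -/(p _.+1).
have -> : step_index delta b = p (size s) by rewrite /p nth_last/= (eqP lasts).
have -> : step_index delta a = p 0%N by [].
rewrite -(telescope_sumr (fun i => dissipation psi eta x y (p i)))//.
rewrite [leLHS]big_nat [leRHS]big_nat; apply: ler_sum => i /andP[_ is_].
apply: gauge_dissipation; apply: step_index_le => //; apply: ltW.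
by have /(pathP b) := ps; apply.
Qed.

End partition_sums.

Section limit.
Context {R : realType} {n m : nat}.
Notation mu := (@lebesgue_measure R).
Variables (A : 'M[R]_(n, m)) (J psi : 'rV[R]_n -> R) (eta : R) (v0 : 'rV[R]_n).
Variables (T : R) (f df : R -> 'rV[R]_m).
Hypotheses (T0 : 0 < T) (hf : W12 T f df).
Hypotheses (J_cont : continuous J) (psi_cont : continuous psi).
Hypotheses (psi_ge0 : forall v, 0 <= psi v) (P1 : Psi1 psi) (P2 : Psi2 psi).
Hypothesis eta_gt0 : 0 < eta.
Variables (M : R) (delta : nat -> R) (x y : nat -> nat -> 'rV[R]_n)
  (q : nat -> nat -> 'cV[R]_m) (kappa : nat -> nat -> 'cV[R]_n).
Hypotheses (delta0 : forall k, 0 < delta k) (deltaC : delta k @[k --> \oo] --> 0).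
Hypothesis ds : forall k, discrete_solution A J psi eta v0
  (fun t => f (clamp T t)) M (delta k) (x k) (y k) (q k) (kappa k).
Variables (v : R -> 'rV[R]_n) (W : R -> R).

Let idx k := step_index (delta k).
Let diss k t := dissipation psi eta (x k) (y k) (idx k t).

Hypotheses (xv : forall t, x k (idx k t) @[k --> \oo] --> v t)
  (dissW : forall t, diss k t @[k --> \oo] --> W t).

Let M0 : 0 <= M.
Proof. exact: le_trans (ds_bounded (ds 0) 0). Qed.

Lemma limit_dissipation_le : {homo W : s t / s <= t}.
Proof.
move=> s t st; apply: (@ler_cvg_to _ \oo _ _ (diss ^~ s) (diss ^~ t)) => //.
by apply: nearW => k; apply: dissipation_le => //; [exact: ltW|exact: step_index_le].
Qed.

(** Where the limit dissipation does not jump to the right, the proximal step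
    is negligible, because it is paid for by the dissipation of one time step. *)
Lemma prox_gap_cvg (t : R) : 0 <= t ->
  (forall e, 0 < e -> exists2 s, t < s & W s - W t < e) ->
  y k (idx k t) - x k (idx k t) @[k --> \oo] --> (0 : 'rV[R]_n).
Proof.
move=> t0 Wt; apply/cvgrPdist_le => e e0.
have [s ts Ws] := Wt _ (mulr_gt0 eta_gt0 (mulr_gt0 e0 e0)).
have dst : (diss k s - diss k t) @[k --> \oo] --> W s - W t by apply: cvgB; exact: dissW.
near=> k; rewrite sub0r normrN.
apply: le_trans (norm_le_enorm _) _.
have h1 : diss k s - diss k t < eta * (e * e) by near: k; exact: (cvgr_lt _ dst).
have dk : delta k < s - t by near: k; apply: (cvgr_lt _ deltaC); rewrite subr_gt0.
have ik : (idx k t < idx k s)%N.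
  have /andP[i1 i2] := step_index_itv (delta0 k) t0.
  rewrite -[X in (X <= _)%N](@step_index_cell _ (delta k) (delta0 k) (idx k t).+1 ((idx k t).+1%:R * delta k)).
    by apply: step_index_le => //; rewrite -natr1 mulrDl mul1r; lra.
  by rewrite lexx/= ltr_pM2r ?delta0// ltr_nat.
have h2 := @dissipation_le _ _ psi eta psi_ge0 (ltW eta_gt0) (x k) (y k) _ _ ik.
have h3 : eta * enorm (y k (idx k t) - x k (idx k t)) ^+ 2 <= diss k s - diss k t.
  move: h2; rewrite {1}/dissipation big_ord_recr/= -/(dissipation psi eta (x k) (y k) (idx k t)).
  by have := psi_ge0 (x k (idx k t).+1 - x k (idx k t)); rewrite /diss; lra.
have : enorm (y k (idx k t) - x k (idx k t)) ^+ 2 <= e ^+ 2.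
  by rewrite -(ler_pM2l eta_gt0) [e ^+ 2]expr2 (le_trans h3)// ltW.
by rewrite ler_sqr ?nnegrE ?enorm_ge0// ltW.
Unshelve. all: by end_near. Qed.

Let z k t : 'cV[R]_(m + n) := col_mx (q k (idx k t)) (kappa k (idx k t)).
Let g t : 'rV[R]_(m + n) := row_mx (df t) 0.

Let pairing (Z : 'cV[R]_(m + n)) t : duality Z (g t) = duality (usubmx Z) (df t).
Proof.
by rewrite /duality -{1}[Z]vsubmxK mul_row_col mul0mx addr0.
Qed.

(** The multipliers and the forces in [K^*] are selected together, so that one
    subsequence realizes both limits at a given time. *)
Lemma limit_multiplier : exists (q0 : R -> 'cV[R]_m) (kappa0 : R -> 'cV[R]_n),
  [/\ forall j, measurable_fun `[0, T] (fun s => q0 s j 0),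
      forall s, 0 <= s <= T -> forall j, `|q0 s j 0| <= M,
      forall s, 0 <= s <= T -> exists phi : nat -> nat,
        [/\ forall i, (i <= phi i)%N,
            forall j, q (phi i) (idx (phi i) s) j 0 @[i --> \oo] --> q0 s j 0 &
            forall j, kappa (phi i) (idx (phi i) s) j 0 @[i --> \oo] --> kappa0 s j 0] &
      forall s, 0 <= s <= T -> forall e, 0 < e ->
        \forall k \near \oo, duality (q k (idx k s)) (df s) < duality (q0 s) (df s) + e].
Proof.
have [|||Z [mZ Zcl Zup ZM]] := @measurable_cluster_vec _ _ R `[0, T]%classic _ z g M.
- move=> k j.
  by apply: (measurable_step (delta0 k) (fun i => col_mx (q k i) (kappa k i) j 0)).
- move=> j; rewrite /g; case: (split_ordP j) => i ->.
    rewrite (_ : (fun s => _) = (fun s => df s 0 i)); first exact: (measurable_derivative hf).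
    by apply/funext => s; rewrite row_mxEl.
  rewrite (_ : (fun s => _) = (fun=> 0)); first exact: measurable_cst.
  by apply/funext => s; rewrite row_mxEr mxE.
- move=> k s j; rewrite /z; case: (split_ordP j) => i ->.
    by rewrite col_mxEu; exact: (ds_multiplier (ds k)).
  by rewrite col_mxEd; exact: (ds_force (ds k)).
have inD s : 0 <= s <= T -> `[0, T]%classic s by rewrite /= in_itv.
exists (fun s => usubmx (Z s)), (fun s => dsubmx (Z s)); split.
- move=> j; rewrite (_ : (fun s => _) = (fun s => Z s (lshift n j) 0)); first exact: mZ.
  by apply/funext => s; rewrite mxE.
- by move=> s /inD sD j; rewrite mxE; exact: ZM.
- move=> s /inD sD.
  have /choice[phi hphi] : forall i : nat, exists k, (i <= k)%N /\
      forall j, `|z k s j 0 - Z s j 0| < i.+1%:R^-1.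
    move=> i; have [|k ik hk] := Zcl s sD (i.+1%:R^-1) i; first by rewrite invr_gt0.
    by exists k.
  have zc j : z (phi i) s j 0 @[i --> \oo] --> Z s j 0.
    apply/cvgrPdist_le => e e0; near=> i; rewrite distrC.
    apply/ltW/(lt_trans ((hphi i).2 j)).
    by near: i; exact: (near_infty_natSinv_lt (PosNum e0)).
  exists phi; split => [i|j|j]; first by have [] := hphi i.
    by have := zc (lshift n j); rewrite mxE; under eq_fun do rewrite col_mxEu.
  by have := zc (rshift m j); rewrite mxE; under eq_fun do rewrite col_mxEd.
- move=> s /inD sD e e0; have := Zup s sD e e0; apply: filterS => k.
  by rewrite !pairing col_mxKu.
Unshelve. all: by end_near. Qed.

Variables (q0 : R -> 'cV[R]_m) (kappa0 : R -> 'cV[R]_n).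
Hypotheses (mq0 : forall j, measurable_fun `[0, T] (fun s => q0 s j 0))
  (q0M : forall s, 0 <= s <= T -> forall j, `|q0 s j 0| <= M)
  (q0cl : forall s, 0 <= s <= T -> exists phi : nat -> nat,
    [/\ forall i, (i <= phi i)%N,
        forall j, q (phi i) (idx (phi i) s) j 0 @[i --> \oo] --> q0 s j 0 &
        forall j, kappa (phi i) (idx (phi i) s) j 0 @[i --> \oo] --> kappa0 s j 0])
  (q0up : forall s, 0 <= s <= T -> forall e, 0 < e ->
    \forall k \near \oo, duality (q k (idx k s)) (df s) < duality (q0 s) (df s) + e).

Let subseq_cvg (U : topologicalType) (u : nat -> U) (l : U) (phi : nat -> nat) :
  (forall i, (i <= phi i)%N) -> u k @[k --> \oo] --> l -> u (phi i) @[i --> \oo] --> l.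
Proof.
move=> hphi; apply: (@cvg_comp _ _ _ phi u); move=> B [N _ NB].
by exists N => // i /= Ni; apply: NB => /=; exact: leq_trans Ni (hphi i).
Qed.

(** Along the subsequence that realizes [q0 t] and [kappa0 t], the proximal
    points tend to [v t], and their subgradients converge. *)
Lemma limit_inclusion (t : R) : 0 <= t <= T ->
  (forall e, 0 < e -> exists2 s, t < s & W s - W t < e) ->
  [set xi + ka | xi in subdifferential J (v t) & ka in Kstar psi] (A *m q0 t).
Proof.
move=> tT Wt; have /andP[t0 _] := tT.
have [phi [iphi qc kc]] := q0cl tT.
have gap := subseq_cvg iphi (prox_gap_cvg t0 Wt).
have xc := subseq_cvg iphi (@xv t).
have yc : y (phi i) (idx (phi i) t) @[i --> \oo] --> v t.
  apply: row_cvg => j.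
  have -> : v t 0 j = v t 0 j + (0 : 'rV[R]_n) 0 j by rewrite mxE addr0.
  have -> : (fun i => y (phi i) (idx (phi i) t) 0 j) = (fun i => x (phi i) (idx (phi i) t) 0 j
      + (y (phi i) (idx (phi i) t) - x (phi i) (idx (phi i) t)) 0 j).
    by apply/funext => i; rewrite !mxE subrKC.
  by apply: cvgD; [exact: row_cvg_coord|exact: (row_cvg_coord gap)].
exists (A *m q0 t - kappa0 t); last first.
  exists (kappa0 t); last by rewrite subrK.
  apply: (@quadratic_subdifferential _ _ psi 0 _ 0) => // w.
  rewrite (P1 0).2// add0r mul0r !subr0.
  apply: (@ler_cvg_to _ \oo _ _ (fun i => duality (kappa (phi i) (idx (phi i) t)) w) (fun=> psi w)).
  - by apply: duality_cvg => //; exact: cvg_cst.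
  - exact: cvg_cst.
  - by apply: nearW => i; exact: (ds_Kstar (ds _)).
apply: (quadratic_subdifferential (ltW eta_gt0)).
apply: (subgradient_limit J_cont yc _ (fun i => ds_subgradient (ds (phi i)) (idx (phi i) t))).
move=> j; rewrite !mxE -[X in _ --> X]subr0.
under eq_fun do rewrite !mxE.
apply: cvgB; first apply: cvgB; last 1 first.
- rewrite -(mulr0 (2 * eta)); apply: cvgMr.
  by have := row_cvg_coord (j := j) gap; rewrite mxE; under eq_fun do rewrite !mxE.
- by apply: cvg_seq_sum => l; apply: cvgMr; exact: qc.
- exact: kc.
Qed.

Let power k s := duality (q k (idx k s)) (df s).
Let power0 s := duality (q0 s) (df s).
Let bound s := M * \sum_j `|df s 0 j|.

Let bound_integrable : mu.-integrable `[0, T] (EFin \o bound).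
Proof. by apply: integrable_scale => //; exact: speed_integrable hf. Qed.

Let power0_le s : 0 <= s <= T -> `|power0 s| <= bound s.
Proof. by move=> sT; apply: duality_derivative_le; exact: q0M. Qed.

Let power0_measurable : measurable_fun `[0, T] power0.
Proof. by apply: measurable_duality => j //; exact: (measurable_derivative hf). Qed.

Lemma limit_power_integrable : mu.-integrable `[0, T] (EFin \o power0).
Proof.
apply: le_integrable bound_integrable => //; first exact/measurable_EFinP.
move=> s /=; rewrite in_itv/= => sT; rewrite lee_fin.
by apply: le_trans (power0_le sT) _; rewrite ler_norm.
Qed.

Let power_max k s : R := Num.max (power k s) (power0 s).

Let power_max_le k s : 0 <= s <= T -> `|power_max k s| <= bound s.
Proof.
move=> sT; have h1 : `|power k s| <= bound s.
  by apply: duality_derivative_le; exact: (ds_multiplier (ds k)).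
have h2 := power0_le sT; rewrite ler_norml /power_max le_max ge_max.
by move: h1 h2; rewrite !ler_norml => /andP[-> ->] /andP[-> ->].
Qed.

Let power_max_measurable k : measurable_fun `[0, T] (power_max k).
Proof.
apply: (measurable_maxr (f := power k) (g := power0)) => //.
apply: measurable_duality => j; first exact: measurable_step_entry.
exact: (measurable_derivative hf).
Qed.

Let power_max_integrable k : mu.-integrable `[0, T] (EFin \o power_max k).
Proof.
apply: le_integrable bound_integrable => //; first by apply/measurable_EFinP; exact: power_max_measurable.
move=> s /=; rewrite in_itv/= => sT; rewrite lee_fin.
by apply: le_trans (power_max_le k sT) _; rewrite ler_norm.
Qed.

(** The discrete powers are only bounded above by the limit power, up to an
    error that tends to [0] at each time; the maximum of the two converges. *)
Lemma power_max_cvg (t1 t2 : R) : 0 <= t1 -> t2 <= T ->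
  (\int[mu]_(s in `[t1, t2]) power_max k s) @[k --> \oo] -->
  \int[mu]_(s in `[t1, t2]) power0 s.
Proof.
move=> t10 t2T.
have sub : `[t1, t2] `<=` `[0, T] by apply: subset_itv; rewrite bnd_simp.
have [] := @dominated_convergence _ _ _ mu `[t1, t2] _
  (fun k s => (power_max k s)%:E) (fun s => (power0 s)%:E) (EFin \o bound).
- exact: measurable_itv.
- move=> k; apply/measurable_EFinP.
  exact: (measurable_funS (measurable_itv _) sub (power_max_measurable k)).
- apply/measurable_EFinP.
  exact: (measurable_funS (measurable_itv _) sub power0_measurable).
- apply: aeW => s /sub /=; rewrite in_itv/= => sT.
  apply: cvg_EFin; first exact: nearW.
  apply/cvgrPdist_le => e e0; have := q0up sT e0; apply: filterS => k /= hk.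
  rewrite /power_max distrC ger0_norm ?subr_ge0 ?le_max ?lexx ?orbT//.
  by rewrite lerBlDl ge_max lerDl (ltW e0) andbT ltW.
- exact: integrable_itv_sub bound_integrable.
- apply: aeW => s k /sub /=; rewrite in_itv/= lee_fin; exact: power_max_le.
move=> ih _ lim; apply: fine_cvg; rewrite fineK//.
by apply: integrable_fin_num => //; exact: measurable_itv.
Qed.

(** The partition sums at the discrete level are absorbed by the dissipation,
    and the incomplete time steps at both ends by the continuity of [f]. *)
Lemma limit_energy (t1 t2 : R) (s : seq R) : 0 <= t1 -> t1 <= t2 -> t2 <= T ->
  itv_partition t1 t2 s ->
  J (v t2) + \sum_(0 <= i < size s)
    psi (v (nth t2 (t1 :: s) i.+1) - v (nth t2 (t1 :: s) i)) <=
  J (v t1) + \int[mu]_(s in `[t1, t2]) power0 s.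
Proof.
move=> t10 t12 t2T ps; apply/ler_addgt0Pr => e e0.
have [_ _ _ acf] := hf.
have c0 : 0 < 2 * (m%:R * M) + 1 by rewrite ltr_wpDl// !mulr_ge0.
have [d d0 hd] := clamp_modulus (ltW T0) acf (divr_gt0 e0 c0).
pose p i := nth t2 (t1 :: s) i.
apply: (@ler_cvg_to _ \oo _ _
  (fun k => J (x k (idx k t2)) + \sum_(0 <= i < size s)
     psi (x k (idx k (p i.+1)) - x k (idx k (p i))))
  (fun k => J (x k (idx k t1)) +
     \int[mu]_(s in `[t1, t2]) power_max k s + e)).
- apply: cvgD; first exact: (continuous_seq J_cont (@xv t2)).
  apply: cvg_seq_sum => i; apply: (continuous_seq psi_cont).
  apply: row_cvg => j; rewrite !mxE; under eq_fun do rewrite !mxE.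
  by apply: cvgB; apply: row_cvg_coord; exact: xv.
- apply: cvgD; last exact: cvg_cst.
  by apply: cvgD; [exact: (continuous_seq J_cont (@xv t1))|exact: power_max_cvg].
- near=> k.
  have dk : delta k < d by near: k; exact: (cvgr_lt _ deltaC).
  have hw a b : a <= b -> b <= a + delta k -> `|f (clamp T b) - f (clamp T a)| <=
      e / (2 * (m%:R * M) + 1).
    by move=> ab bd; apply: hd => //; rewrite (le_trans bd)// lerD2l ltW.
  have E : J (x k (idx k t2)) + (diss k t2 - diss k t1) <= J (x k (idx k t1)) +
      \int[mu]_(s in `[t1, t2]) power k s + 2 * (m%:R * M * (e / (2 * (m%:R * M) + 1))).
    exact: (discrete_energy T0 hf (delta0 k) (ds k) t10 t12 t2T hw).
  have V : \sum_(0 <= i < size s) psi (x k (idx k (p i.+1)) - x k (idx k (p i))) <=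
      diss k t2 - diss k t1.
    exact: (partition_dissipation P1 P2 (ltW eta_gt0) (x k) (y k) (delta0 k) ps).
  have ip := power_integrable hf (delta0 k) (ds k).
  have ip12 := integrable_itv_sub t10 t2T ip.
  have I : \int[mu]_(s in `[t1, t2]) power k s <=
      \int[mu]_(s in `[t1, t2]) power_max k s.
    apply: le_Rintegral => //.
      exact: (integrable_itv_sub t10 t2T (power_max_integrable k)).
    by move=> r _; rewrite le_max lexx.
  have small : 2 * (m%:R * M * (e / (2 * (m%:R * M) + 1))) <= e.
    rewrite [leLHS](_ : _ = e * ((2 * (m%:R * M)) / (2 * (m%:R * M) + 1))); last by ring.
    by rewrite ler_piMr ?(ltW e0)// ler_pdivrMr// mul1r lerDl.
  apply: le_trans (lerD (lexx _) V) (le_trans E _).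
  by apply: lerD small; apply: lerD I.
Unshelve. all: by end_near. Qed.

End limit.

(** * Discrete evolutions and their limit *)

Section approximable.
Context {R : realType} {n m : nat}.
Variables (A : 'M[R]_(n, m)) (J psi : 'rV[R]_n -> R) (eta : R) (v0 : 'rV[R]_n).
Variables (T : R) (f : R -> 'rV[R]_m).
Hypothesis hv0 : critical_point A (fun v => J v + psi (v - v0)) (f 0) v0.

Lemma discrete_solution_evolution (M delta : R) (x y : nat -> 'rV[R]_n)
    (q : nat -> 'cV[R]_m) (kappa : nat -> 'cV[R]_n) : 0 < delta ->
  discrete_solution A J psi eta v0 (fun t => f (clamp T t)) M delta x y q kappa ->
  discrete_evolution A J psi T v0 f delta (fun t => x (step_index delta t)).
Proof.
move=> delta0 ds; split.
- move=> t _; apply: cvg_near_cst; have := step_index_right delta0 t.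
  by apply: filterS => s ->.
- by move=> t /andP[_ td] _; rewrite (step_index0 delta0 td) (ds_init ds).
- move=> i _ s t si _ ti _; rewrite natr1 in si ti.
  by rewrite (step_index_cell delta0 si) (step_index_cell delta0 ti).
- have idx i : step_index delta (i%:R * delta) = i.
    by apply: step_index_cell => //; rewrite lexx/= ltr_pM2r// ltr_nat.
  move=> [|i] iT; rewrite idx.
    have -> : step_index delta ((0%:R - 1) * delta) = 0%N.
      by apply: step_index0 => //; rewrite sub0r mulN1r; lra.
    by rewrite mul0r (ds_init ds).
  have -> : i.+1%:R - 1 = i%:R :> R by rewrite -natr1 addrK.
  rewrite idx; have := ds_critical ds i; rewrite clamp_id// iT andbT.
  by rewrite mulr_ge0// ltW.
Qed.

Variables (M : R) (delta : nat -> R) (x y : nat -> nat -> 'rV[R]_n)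
  (q : nat -> nat -> 'cV[R]_m) (kappa : nat -> nat -> 'cV[R]_n).
Hypotheses (delta0 : forall k, 0 < delta k) (deltaC : delta k @[k --> \oo] --> 0).
Hypothesis ds : forall k, discrete_solution A J psi eta v0
  (fun t => f (clamp T t)) M (delta k) (x k) (y k) (q k) (kappa k).
Variable v : R -> 'rV[R]_n.
Hypothesis xv : forall t, x k (step_index (delta k) t) @[k --> \oo] --> v t.

Lemma limit_approximable : approximable_evolution A J psi T v0 f v.
Proof.
have M0 : 0 <= M by exact: le_trans (ds_bounded (ds 0) 0).
have vM t j : `|v t 0 j| <= M.
  apply: (@ler_cvg_to _ \oo _ _ (fun k => `|x k (step_index (delta k) t) 0 j|) (fun=> M)).
  - by apply: cvg_norm; exact: (row_cvg_coord (@xv t)).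
  - exact: cvg_cst.
  - by apply: nearW => k; exact: le_trans (mx_coord_le _ _ _) (ds_bounded (ds k) _).
split.
- exists M; split; first exact: num_real.
  move=> c Mc _ [t _ <-]; apply: le_trans (ltW Mc).
  by apply: mx_norm_le => // i j; rewrite ord1.
- move=> i j; rewrite ord1.
  apply: (@measurable_fun_cvg _ _ _ _
    (fun k t => x k (step_index (delta k) t) 0 j)).
    by move=> k; exact: (measurable_step (delta0 k) (fun i => x k i 0 j)).
  by move=> t _; exact: (row_cvg_coord (@xv t)).
- exists delta, (fun k t => x k (step_index (delta k) t)); split; [exact: delta0|exact: deltaC| |].
    by move=> k; exact: (discrete_solution_evolution (delta0 k) (ds k)).
  move=> t _.
  have /cvg_limn_einf_sup[-> _] // : (enorm (x k (step_index (delta k) t) - v t))%:E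
      @[k --> \oo] --> 0%E.
  apply: cvg_EFin; first exact: nearW.
  apply: (@squeeze_cvgr _ _ _ _ (fun=> 0) (fun k => n%:R * `|x k (step_index (delta k) t) - v t|)).
  - by apply: nearW => k /=; rewrite enorm_ge0 enorm_le_norm.
  - exact: cvg_cst.
  - rewrite -(mulr0 n%:R); apply: cvgMr.
    rewrite -(normr0 'rV[R]_n) -(subrr (v t)); apply: cvg_norm.
    by apply: cvgB; [exact: xv|exact: cvg_cst].
Qed.

End approximable.

Lemma essentially_bounded_Lfun (R : realType) (T M : R) (h : R -> R) : 0 <= M ->
  measurable_fun `[0, T] h -> (forall t, 0 <= t <= T -> `|h t| <= M) ->
  h \_ `[0, T] \in Lfun (@lebesgue_measure R) +oo%E.
Proof.
move=> M0 mh hM; apply/andP; split; rewrite inE/=.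
  by apply/(measurable_restrictT _ (measurable_itv _)).
rewrite /finite_norm unlock; case: ifPn => // _.
apply: (@le_lt_trans _ _ M%:E); last exact: ltry.
apply/ess_supP; apply: aeW => t /=; rewrite lee_fin patchE.
by case: ifPn => [|_]; [rewrite inE/= in_itv/=; exact: hM|rewrite normr0].
Qed.

Lemma Var_le (R : realType) (n : nat) (phi : 'rV[R]_n -> R) (u : R -> 'rV[R]_n) (a b c : R) :
  (forall s, itv_partition a b s ->
    \sum_(0 <= i < size s) phi (u (nth b (a :: s) i.+1) - u (nth b (a :: s) i)) <= c) ->
  (Var phi u a b <= c%:E)%E.
Proof. by move=> h; apply: ge_ereal_sup => _ [s ps <-]; rewrite lee_fin; exact: h. Qed.

(** * Compactness of the discrete solutions *)

(** The components of the discrete evolutions have increments controlled by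
    those of the dissipation, since [psi] dominates a multiple of the norm. *)
Lemma discrete_solution_compactness (R : realType) (n m : nat) (A : 'M[R]_(n, m))
    (J psi : 'rV[R]_n -> R) (eta : R) (v0 : 'rV[R]_n) (f : R -> 'rV[R]_m) (M d : R) :
  (forall v, 0 <= psi v) -> Psi1 psi -> Psi2 psi -> Psi3 psi -> 0 <= eta -> 0 < d ->
  (forall delta, 0 < delta <= d -> exists x y q kappa,
    discrete_solution A J psi eta v0 f M delta x y q kappa) ->
  exists (delta : nat -> R) (x y : nat -> nat -> 'rV[R]_n) (q : nat -> nat -> 'cV[R]_m)
      (kappa : nat -> nat -> 'cV[R]_n) (v : R -> 'rV[R]_n) (W : R -> R),
    [/\ forall k, 0 < delta k,
        delta k @[k --> \oo] --> 0,
        forall k, discrete_solution A J psi eta v0 f M (delta k) (x k) (y k) (q k) (kappa k),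
        forall t, x k (step_index (delta k) t) @[k --> \oo] --> v t &
        forall t, dissipation psi eta (x k) (y k) (step_index (delta k) t)
          @[k --> \oo] --> W t].
Proof.
move=> psi_ge0 P1 P2 P3 eta0 d0 hd.
pose delta k : R := d * harmonic k.
have delta0 k : 0 < delta k by rewrite mulr_gt0// harmonic_gt0.
have deltad k : delta k <= d.
  by rewrite ler_piMr ?(ltW d0)// invf_le1 ?ltr0n// ler1n.
have deltaC : delta k @[k --> \oo] --> 0.
  by rewrite -(mulr0 d); apply: cvgMr; exact: cvg_harmonic.
have /choice[D hD] : forall k, exists D : (nat -> 'rV[R]_n) * (nat -> 'rV[R]_n) *
    (nat -> 'cV[R]_m) * (nat -> 'cV[R]_n),
    discrete_solution A J psi eta v0 f M (delta k) D.1.1.1 D.1.1.2 D.1.2 D.2.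
  move=> k; have [|x [y [q [kappa h]]]] := hd (delta k); first by rewrite delta0 deltad.
  by exists (x, y, q, kappa).
pose x k := (D k).1.1.1; pose y k := (D k).1.1.2; pose idx k := step_index (delta k).
pose diss k t := dissipation psi eta (x k) (y k) (idx k t).
have [c c0 hc] := gauge_ge_norm psi_ge0 P1 P2 P3.
have M0 : 0 <= M by exact: le_trans (ds_bounded (hD 0) 0).
have diss0 k t : 0 <= diss k t.
  by apply: sumr_ge0 => l _; rewrite addr_ge0// mulr_ge0// sqr_ge0.
have dissM k t : diss k t <= M by exact: (ds_variation (hD k)).
have [||||phi [W [l [hphi hW hl]]]] := @helly _ 'I_n (fun k t => diss k t / c)
    (fun i k t => x k (idx k t) 0 i) (M + M / c).
- move=> k s t st; rewrite ler_pM2r ?invr_gt0//; apply: dissipation_le => //.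
  exact: step_index_le.
- move=> k t; rewrite ger0_norm ?divr_ge0 ?(ltW c0)//.
  by rewrite ler_wpDl// ler_pM2r ?invr_gt0.
- move=> i k t; apply: le_trans (mx_coord_le _ _ _) _.
  by apply: le_trans (ds_bounded (hD k) _) _; rewrite lerDl divr_ge0// ltW.
- move=> i k s t st; rewrite -mulrBl ler_pdivlMr// mulrC.
  have -> : x k (idx k t) 0 i - x k (idx k s) 0 i = (x k (idx k t) - x k (idx k s)) 0 i.
    by rewrite !mxE.
  apply: le_trans (gauge_dissipation P1 P2 eta0 (x k) (y k) (step_index_le (delta0 k) st)).
  by apply: le_trans (hc _); rewrite ler_pM2l//; exact: mx_coord_le.
exists (delta \o phi), (x \o phi), (y \o phi), (fun k => (D (phi k)).1.2),
  (fun k => (D (phi k)).2), (fun t => \row_i l i t), (fun t => W t * c); split => /=.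
- by move=> k; exact: delta0.
- apply: (@cvg_comp _ _ _ phi delta _ \oo) => //.
  by move=> B [N _ NB]; exists N => // i /= Ni; apply: NB => /=; exact: leq_trans Ni (hphi i).
- by move=> k; exact: hD.
- by move=> t; apply: row_cvg => j; rewrite mxE; exact: hl.
- move=> t; rewrite (_ : (fun k => _) = (fun k => diss (phi k) t / c * c)).
    by apply: cvgMl; exact: hW.
  by apply/funext => k; rewrite divfK// gt_eqF.
Qed.

Theorem theorem2p15 (R : realType) (n m : nat) (nm : (m < n)%N) (T : R) (T0 : 0 < T)
    (A : 'M[R]_(n, m)) (surjA : forall g : 'rV[R]_m, exists v : 'rV[R]_n, v *m A = g)
    (J : 'rV[R]_n -> R) (J_ge0 : forall v, 0 <= J v)
    (hJ1 : J1 A J) (hJ2 : J2 J) (hJ3 : J3 J)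
    (psi : 'rV[R]_n -> R) (psi_ge0 : forall v, 0 <= psi v)
    (hPsi1 : Psi1 psi) (hPsi2 : Psi2 psi) (hPsi3 : Psi3 psi)
    (f df : R -> 'rV[R]_m) (hf : W12 T f df)
    (v0 : 'rV[R]_n)
    (hv0 : critical_point A (fun v => J v + psi (v - v0)) (f 0) v0) :
  exists (v : R -> 'rV[R]_n) (q : R -> 'cV[R]_m),
    [/\ BV_vec T v,
        Lp_vec +oo%E T q,
        approximable_evolution A J psi T v0 f v,
        {ae lebesgue_measure, forall t : R, 0 <= t <= T ->
           [set xi + kappa | xi in subdifferential J (v t) & kappa in Kstar psi]
             (A *m q t)} &
        lebesgue_measure.-integrable `[0, T] (fun s => (duality (q s) (df s))%:E) /\
        forall t1 t2 : R, 0 <= t1 -> t1 < t2 -> t2 <= T ->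
          ((J (v t2))%:E + Var psi v t1 t2 <=
           (J (v t1))%:E +
             \int[lebesgue_measure]_(s in `[t1, t2]) (duality (q s) (df s))%:E)%E].
Proof.
have [eta eta0 [/convex_functionP S_cvx _]] := hJ2.
have J_cont := semiconvex_continuous S_cvx.
have psi_cont := cvx_continuous (gauge_cvx hPsi2 hPsi3).
have T0' := ltW T0; have [_ _ _ acf] := hf.
have f0 : f (clamp T 0) = f 0 by rewrite clamp_id// lexx.
have v0A : v0 *m A = f (clamp T 0) by rewrite f0; case: hv0.
have [d d0 [M M0 hM]] : exists2 d : R, 0 < d & exists2 M : R, 0 < M &
    forall delta, 0 < delta <= d -> exists x y q kappa,
      discrete_solution A J psi eta v0 (fun t => f (clamp T t)) M delta x y q kappa.
  have [|||M M0 [d d0 h]] := @discrete_solution_exists _ _ _ A J psi eta v0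
    (fun t => f (clamp T t)) surjA J_ge0 hJ1 hJ3 (ltW eta0) S_cvx psi_ge0 hPsi1 hPsi2 hPsi3
    v0A (clamp_length T df) (clamp_length T df T).
  - by move=> t _; exact: (clamp_length_bounded T0 hf).
  - by move=> a b _; exact: (clamp_length_le T0 hf).
  - by move=> e e0; have [d d0 h] := clamp_modulus T0' acf e0; exists d => // a b _; exact: h.
  by exists d => //; exists M.
have [delta [x [y [q [kappa [v [W [delta0 deltaC ds xv dissW]]]]]]]] :=
  discrete_solution_compactness psi_ge0 hPsi1 hPsi2 hPsi3 (ltW eta0) d0 hM.
have [q0 [kappa0 [mq0 q0M q0cl q0up]]] := limit_multiplier hf delta0 ds.
have ip := limit_power_integrable hf mq0 q0M.
have energy := limit_energy T0 hf J_cont psi_cont hPsi1 hPsi2 eta0 delta0 deltaC ds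
  xv mq0 q0M q0up.
exists v, q0; split.
- have [c c0 hc] := gauge_ge_norm psi_ge0 hPsi1 hPsi2 hPsi3.
  pose B := n%:R / c * (J (v 0) +
    \int[lebesgue_measure]_(s in `[0, T]) duality (q0 s) (df s)).
  apply: (@le_lt_trans _ _ B%:E); last exact: ltry.
  apply: Var_le => s ps.
  apply: le_trans (_ : n%:R / c * \sum_(0 <= i < size s)
    psi (v (nth T (0 :: s) i.+1) - v (nth T (0 :: s) i)) <= _).
    rewrite mulr_sumr; apply: ler_sum => i _; apply: le_trans (enorm_le_norm _) _.
    by rewrite -mulrA ler_wpM2l// mulrC ler_pdivlMr// mulrC.
  apply: ler_wpM2l; first by rewrite divr_ge0// ltW.
  by apply: le_trans (energy _ _ _ _ _ _ ps) => //; rewrite lerDr.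
- move=> i j; rewrite ord1.
  by apply: (essentially_bounded_Lfun (ltW M0)) => // t tT; exact: q0M.
- exact: (limit_approximable hv0 delta0 deltaC ds xv).
- apply: negligibleS (right_jumps_negligible (limit_dissipation_le psi_ge0 eta0 delta0 dissW)).
  move=> t nt; apply: contrapT => jump; apply: nt => tT.
  apply: (limit_inclusion J_cont psi_ge0 hPsi1 eta0 delta0 deltaC ds xv dissW q0cl tT) => e e0.
  apply: contrapT => no; apply: jump; exists e => // s ts.
  by rewrite leNgt; apply/negP => h; apply: no; exists s.
- split=> // t1 t2 t10 t12 t2T.
  have ip12 := integrable_itv_sub t10 t2T ip.
  set I := (\int[_]_(s in _) _)%E.
  have If : I = (\int[lebesgue_measure]_(s in `[t1, t2]) duality (q0 s) (df s))%:E.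
    by rewrite /Rintegral fineK//; exact: integrable_fin_num.
  have h : (Var psi v t1 t2 <= (J (v t1) +
      \int[lebesgue_measure]_(s in `[t1, t2]) duality (q0 s) (df s) - J (v t2))%:E)%E.
    by apply: Var_le => s ps; rewrite lerBrDl; exact: energy (ltW t12) _ ps.
  apply: le_trans (leeD2l _ h) _.
  by rewrite If -!EFinD lee_fin addrC subrK.
Qed.
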